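(* Let $m,n$ be positive integers and let $\mu,\nu$ be two (positive) partitions. Assume that all parameters $q,s,x_1,\dots,x_m,y_1,\dots,y_n$ are complex numbers in the open unit disc. Then the spin $q$-Whittaker polynomials satisfy $$ \sum_{\lambda} \mathbb{F}_{\lambda/\mu}(x_1,\dots,x_m)\, \mathbb{F}^{*}_{\lambda/\nu}(y_1,\dots,y_n) = \prod_{i=1}^{m}\prod_{j=1}^{n} \left(\frac{(-sx_i;q)_{\infty}(-sy_j;q)_{\infty}}{(s^2;q)_{\infty}(x_iy_j;q)_{\infty}}\right) \sum_{\kappa} \mathbb{F}_{\nu/\kappa}(x_1,\dots,x_m)\, \mathbb{F}^{*}_{\mu/\kappa}(y_1,\dots,y_n), $$ where the left-hand sum is over all partitions $\lambda$ with $\lambda'\supset\mu'$ and $\lambda'\supset\nu'$, and the right-hand sum is over all partitions $\kappa$ with $\kappa'\subset\mu'$ and $\kappa'\subset\nu'$.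
   Context: Fix $q,s\in\mathbb{C}$ with $|q|<1$, $|s|<1$. Write $(a;q)_m=\prod_{i=1}^m(1-aq^{i-1})$ for $m\ge 1$, $(a;q)_0=1$, $(a;q)_\infty=\prod_{i\ge1}(1-aq^{i-1})$. A (positive) partition is a finite, possibly empty, sequence $\lambda_1\ge\dots\ge\lambda_\ell\ge1$ of integers; $\ell(\lambda)=\ell$ is its length, $\lambda_i:=0$ for $i>\ell(\lambda)$, and $\lambda'$ is the conjugate partition. $\lambda\supset\mu$ means $\ell(\lambda)\ge\ell(\mu)$ and $\lambda_i\ge\mu_i$ for all $i$. Vertex weights: for $x\in\mathbb{C}$ and $i,j,k,\ell\in\mathbb{Z}_{\ge0}$, $$W_x(i,j;k,\ell)=\mathbf 1_{i+j=k+\ell}\,\mathbf 1_{i\ge\ell}\;x^\ell\frac{(-s/x;q)_\ell\,(-sx;q)_{i-\ell}\,(q;q)_k}{(q;q)_\ell\,(q;q)_{i-\ell}\,(s^2;q)_k},$$ where $x^\ell(-s/x;q)_\ell$ is read as the polynomial $\prod_{r=0}^{\ell-1}(x+sq^r)$. ($i,j,k,\ell$ are the numbers of paths on the bottom, left, top, right edges of the vertex.) Skew spin $q$-Whittaker polynomial: for partitions $\lambda,\mu$, $$\mathbb{F}_{\lambda/\mu}(x_1,\dots,x_n)=\sum\prod_{r=1}^n\left[x_r^{h_{r,0}}\frac{(-s/x_r;q)_{h_{r,0}}}{(q;q)_{h_{r,0}}}\prod_{c\ge1}W_{x_r}\big(v_{r-1,c},h_{r,c-1};v_{r,c},h_{r,c}\big)\right],$$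 the sum running over all non-negative integers $h_{r,c}$ ($1\le r\le n$, $c\ge0$), with $h_{r,c}=0$ for all large $c$, and $v_{r,c}$ ($0\le r\le n$, $c\ge1$) subject to $v_{0,c}=\mu_c-\mu_{c+1}$ and $v_{n,c}=\lambda_c-\lambda_{c+1}$; all but finitely many vertex weights equal $W_x(0,0;0,0)=1$ in any nonzero term. (Equivalently: the partition function on columns $0,1,2,\dots$ and rows $1,\dots,n$ numbered from bottom to top, row $r$ carrying $x_r$, all left and right boundary edges empty, infinitely many paths in column $0$ with weights $W_x(\infty,0;\infty,\ell)=x^\ell\frac{(-s/x;q)_\ell(-sx;q)_\infty}{(q;q)_\ell(s^2;q)_\infty}$, divided by $\prod_{i=1}^n(-sx_i;q)_\infty/(s^2;q)_\infty$.) Dual polynomials: $$\mathbb{F}^*_{\lambda/\mu}(x_1,\dots,x_n)=\frac{\tilde c_{\lambda'}}{\tilde c_{\mu'}}\,\mathbb{F}_{\lambda/\mu}(x_1,\dots,x_n),\qquad \tilde c_{\lambda'}=\prod_{i\ge1}\frac{(s^2;q)_{\lambda_i-\lambda_{i+1}}}{(q;q)_{\lambda_i-\lambda_{i+1}}}.$$ *)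

(* Defs.v *)
From HB Require Import structures.
From mathcomp Require Import all_boot all_order all_algebra.
From mathcomp Require Import complex finmap.
From mathcomp Require Import all_classical all_reals all_analysis.
From mathcomp Require summability.

Set Implicit Arguments.
Unset Strict Implicit.
Unset Printing Implicit Defensive.

Import Order.TTheory GRing.Theory Num.Theory.
Import numFieldNormedType.Exports.

Local Open Scope classical_set_scope.
Local Open Scope ring_scope.

(** Partitions.  Lists are 0-based: [nth 0 la c] is lambda_(c+1), and is 0 past
    the end of the list. *)

Definition is_intpart (la : seq nat) : bool :=
  sorted geq la && (0%N \notin la).

Record intpart := IntPart {
  parts :> seq nat;
  partsP : is_intpart parts }.

HB.instance Definition _ := [isSub for parts].
HB.instance Definition _ := [Choice of intpart by <:].

(* la contains mu *)
Definition contains (la mu : intpart) : Prop :=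
  (size mu <= size la)%N /\ forall i : nat, (nth 0%N mu i <= nth 0%N la i)%N.

(* The entry of index j is lambda'_(j+1) = #{i | lambda_i >= j+1}. *)
Definition conj_parts (la : seq nat) : seq nat :=
  [seq count (fun p => j < p)%N la | j <- iota 0 (head 0%N la)].

Lemma conj_partsP (la : intpart) : is_intpart (conj_parts la).
Proof.
apply/andP; split.
  apply: (@homo_sorted _ _ _ ltn) (iota_ltn_sorted _ _) => i j lt_ij /=.
  by apply: sub_count => p; apply: ltn_trans.
apply/mapP => -[j]; rewrite mem_iota add0n /= => lt_j.
case: (parts la) lt_j => [|p l] //= lt_j.
by rewrite lt_j.
Qed.

Definition conj_intpart (la : intpart) : intpart :=
  IntPart (conj_partsP la).

(* lambda_(c+1) - lambda_(c+2) *)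
Definition part_step (la : intpart) (c : nat) : nat :=
  (nth 0%N la c - nth 0%N la c.+1)%N.

(** Infinite sums and products. *)

(* Unconditional convergence to l of the sum of f over D, along the finite
   subsets of the index type; for complex-valued f this amounts to absolute
   convergence. *)
Definition has_sum (K : numFieldType) (I : choiceType) (D : set I)
    (f : I -> K) (l : K) : Prop :=
  (fun A : {fset I} => \sum_(i <- A | i \in D) f i)
    @ summability.totally --> l.

Definition infprod (K : numFieldType) (f : nat -> K) : K :=
  limn (fun N : nat => \prod_(i < N) f i).

(** q-Pochhammer symbols. *)

Definition qpoch (K : numFieldType) (q a : K) (m : nat) : K :=
  \prod_(i < m) (1 - a * q ^+ i).

Definition qpoch_inf (K : numFieldType) (q a : K) : K :=
  infprod (fun i : nat => 1 - a * q ^+ i).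

(* The polynomial x^l (-s/x; q)_l, also meaningful at x = 0. *)
Definition xpoch (K : numFieldType) (q s x : K) (l : nat) : K :=
  \prod_(r < l) (x + s * q ^+ r).

(** Spin q-Whittaker polynomials. *)

(* i, j, k, l: numbers of paths on the bottom, left, top, right edges. *)
Definition vweight (K : numFieldType) (q s x : K) (i j k l : nat) : K :=
  if (i + j == k + l)%N && (l <= i)%N then
    xpoch q s x l * qpoch q (- (s * x)) (i - l) * qpoch q q k
      / (qpoch q q l * qpoch q q (i - l) * qpoch q (s ^+ 2) k)
  else 0.

(* For a pair (h, v), [h r c] is the number of paths on the horizontal edge
   leaving column c = 0, 1, 2, ... to the right in row r.+1, and [v r c] the
   number on the vertical edge of column c.+1 between rows r and r.+1. *)
Definition path_config (n : nat) : Type :=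
  (('I_n -> nat -> nat) * ('I_n.+1 -> nat -> nat))%type.

Definition admissible (n : nat) (la mu : intpart) : set (path_config n) :=
  [set hv | [/\ forall r : 'I_n, \forall c \near \oo, hv.1 r c = 0%N,
                hv.2 ord0 = part_step mu
              & hv.2 ord_max = part_step la]].

(* All but finitely many factors of each [infprod] are [vweight 0 0 0 0 = 1],
   unless the conservation of paths fails infinitely often in some row, whose
   [infprod] is then 0. *)
Definition config_weight (K : numFieldType) (q s : K) (n : nat)
    (x : 'I_n -> K) (hv : path_config n) : K :=
  let: (h, v) := hv in
  \prod_(r < n)
    (xpoch q s (x r) (h r 0%N) / qpoch q q (h r 0%N) *
     infprod (fun c : nat =>
       vweight q s (x r) (v (widen_ord (leqnSn n) r) c) (h r c)
                         (v (lift ord0 r) c) (h r c.+1))).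

(* [\sum_(_ \in _)] is the sum over the finite support.  The support is finite
   here: a nonvanishing term forces h_(r,c) = la^r_(c+1) - la^(r-1)_(c+1) for a
   chain mu = la^0, la^1, ..., la^n = la of partitions, increasing for the
   inclusion. *)
Definition spinW (K : numFieldType) (q s : K) (n : nat) (x : 'I_n -> K)
    (la mu : intpart) : K :=
  \sum_(hv \in @admissible n la mu) config_weight q s x hv.

(* The coefficient tilde c at the conjugate of la; the factors beyond the
   length of la are 1. *)
Definition ctilde_conj (K : numFieldType) (q s : K) (la : intpart) : K :=
  \prod_(c < size la)
    (qpoch q (s ^+ 2) (part_step la c) / qpoch q q (part_step la c)).

Definition spinW_dual (K : numFieldType) (q s : K) (n : nat) (x : 'I_n -> K)
    (la mu : intpart) : K :=
  ctilde_conj q s la / ctilde_conj q s mu * spinW q s x la mu.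

(* Main.v *)
(** In one variable, [F_{la/mu}(x)] is a product over columns of elementary
    factors.  In the one-variable Cauchy sums, [la_(c+1)] and [ka_c] range over
    the same interval, and the first sum can be turned into the second one
    column at a time: the local exchange relation [crossing] moves the factor
    [(xy;q)_k / (q;q)_k], taken at [k = ka_c - la_(c+1)], one column to the
    right.  This relation is a symmetry of a terminating balanced 4phi3 series
    (a Sears transformation); it follows by induction from a three-term
    recurrence with a WZ certificate, the q-Saalschuetz sum being the initial
    condition.  Starting the exchange from an extra part [k >= la_1] in front of
    [la] gives an identity between finite sums; letting [k] tend to infinity
    produces the infinite products and the one-variable identity.

    For several variables, the polynomials are matrix coefficients of composed
    one-row kernels.  The rows of these kernels are absolutely summable,
    uniformly on partitions of bounded length, so Fubini applies and the
    exchange relation is multiplicative in each kernel. *)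

Require Import Defs.
From mathcomp Require Import all_boot all_order all_algebra.
From mathcomp Require Import complex finmap.
From mathcomp Require Import all_classical all_reals all_analysis.
From mathcomp Require summability.
From mathcomp Require Import ring zify.

Set Implicit Arguments.
Unset Strict Implicit.
Unset Printing Implicit Defensive.

Import Order.TTheory GRing.Theory Num.Theory.
Import numFieldNormedType.Exports.

Local Open Scope classical_set_scope.
Local Open Scope fset_scope.
Local Open Scope ring_scope.

(** Symmetry follows from the recurrence only after normalisation. With the prefactor of
    [sears_sum], the functions T(a,n) and T(n,a) satisfy the same three-term relation, so induction
    on [a] carries the symmetry from a = 0 to all [a]. The leading coefficient contains q^n; since q
    = 0 is allowed, that case is settled by closed forms. The limit in k takes place inside an
    infinite sum over [la] whose value is the unknown. Its weights (xy;q)_k/(q;q)_k are bounded and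
    tend to a constant which is nonzero because |xy| < 1, so dominated convergence can be read
    backwards: finite identities on growing boxes yield the infinite sum. All the bounds behind this
    come from one fact, that the products of 1 + c|q|^i are bounded. The polynomials are
    finite-support sums, which are 0 by convention on an infinite support. The nonvanishing
    configurations must therefore be listed explicitly before a branching rule can be proved. *)

Local Notation entry := (nth 0%N).

(** * The local exchange relation *)

Section FiniteIdentity.
Variables (K : numFieldType) (q s : K).
Hypothesis q_ok : forall i, 1 - q * q ^+ i != 0.
Hypothesis s_ok : forall i, 1 - s ^+ 2 * q ^+ i != 0.

Lemma qpoch0 (a : K) : qpoch q a 0 = 1.
Proof. by rewrite /qpoch big_ord0. Qed.

Lemma qpochS (a : K) m : qpoch q a m.+1 = qpoch q a m * (1 - a * q ^+ m).
Proof. by rewrite /qpoch big_ord_recr. Qed.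

Lemma xpoch0 (x : K) : xpoch q s x 0 = 1.
Proof. by rewrite /xpoch big_ord0. Qed.

Lemma xpochS (x : K) m : xpoch q s x m.+1 = xpoch q s x m * (x + s * q ^+ m).
Proof. by rewrite /xpoch big_ord_recr. Qed.

Lemma qpoch_qq_neq0 m : qpoch q q m != 0.
Proof. by apply/prodf_neq0 => i _. Qed.

Lemma qpoch_ss_neq0 m : qpoch q (s ^+ 2) m != 0.
Proof. by apply/prodf_neq0 => i _. Qed.

(** The term N = mu + i on the left of the exchange relation, in the coordinates a = k - mu, d = mu
    - nu, n = nu - t. *)
Definition wz_term (x y : K) (d a n i : nat) : K :=
  qpoch q (x * y) (a - i) / qpoch q q (a - i) *
  (xpoch q s x i / qpoch q q i) * (xpoch q s y (i + d) / qpoch q q (i + d)) *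
  (qpoch q q (i + d + n) / qpoch q (s ^+ 2) (i + d + n)).

Definition wz_sum x y d a n := \sum_(i < a.+1) wz_term x y d a n i.

(** The factor 1 - q^i makes the certificate vanish at the lower end i = 0 of the telescoping
    sum. *)
Definition wz_cert (x y : K) (d a n i : nat) : K :=
  q ^+ (a.+1 - i + n) *
  qpoch q (x * y) (a.+1 - i) / qpoch q q (a.+1 - i) *
  (xpoch q s x i / qpoch q q i) * (xpoch q s y (i + d) / qpoch q q (i + d)) *
  (1 - q ^+ i) * (1 - q ^+ (i + d)) *
  (qpoch q q (i + d + n) / qpoch q (s ^+ 2) (i + d + n)).

Lemma wz_pair x y d a n i : (i <= a)%N ->
  q ^+ n * (1 - q * q ^+ a) * (1 - q * q ^+ (a + d)) * wz_term x y d a.+1 n i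
  - q ^+ a * (1 + s * x * q ^+ (n + d)) * (1 + s * y * q ^+ n)
      * wz_term x y d a n.+1 i
  + (q ^+ a - q ^+ n) * (1 - x * y * (q * q ^+ (a + n + d)))
      * wz_term x y d a n i
  = wz_cert x y d a n i - wz_cert x y d a n i.+1.
Proof.
move=> /subnKC <-; move: (a - i)%N => m {a}.
rewrite /wz_term /wz_cert subSS.
have -> : ((i + m).+1 - i = m.+1)%N by lia.
have -> : ((i + m) - i = m)%N by lia.
rewrite ?addnS ?addSn !qpochS !xpochS ?addSn !(exprS q) !(exprD q).
have := q_ok m; have := q_ok i; have := q_ok (i + d); have := s_ok (i + d + n).
have := qpoch_qq_neq0 i; have := qpoch_qq_neq0 m.
have := qpoch_qq_neq0 (i + d).
have := qpoch_ss_neq0 (i + d + n).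
rewrite !(exprD q).
move: (qpoch q q i) (qpoch q q m) (qpoch q q (i + d)) (qpoch q (s ^+ 2) _).
move: (qpoch q q _) (qpoch q _ m) (xpoch _ _ _ _) (xpoch _ _ _ _).
move: (q ^+ i) (q ^+ m) (q ^+ n) (q ^+ d).
move=> Y M N D A1 A2 A3 A4 A5 A6 A7 A8 h1 h2 h3 h4 h5 h6 h7 h8.
by field; rewrite ?expr2 in h5 *; rewrite ?h1 ?h2 ?h3 ?h4 ?h5 ?h6 ?h7 ?h8.
Qed.

Lemma wz_rec x y d a n :
  q ^+ n * (1 - q * q ^+ a) * (1 - q * q ^+ (a + d)) * wz_sum x y d a.+1 n
  - q ^+ a * (1 + s * x * q ^+ (n + d)) * (1 + s * y * q ^+ n)
      * wz_sum x y d a n.+1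
  + (q ^+ a - q ^+ n) * (1 - x * y * (q * q ^+ (a + n + d)))
      * wz_sum x y d a n = 0.
Proof.
(* The sum at [a.+1] has one term more than the other two. It is split off, as [wz_pair] requires i
   <= a, and it cancels against the value of the certificate at i = a + 1. *)
rewrite /wz_sum (big_ord_recr a.+1) /= mulrDr.
set c1 := (X in X * _ + _ - _ + _); set c2 := (X in _ - X * _ + _).
set c3 := (X in _ + X * _ = 0).
transitivity (\sum_(i < a.+1) (wz_cert x y d a n i - wz_cert x y d a n i.+1)
              + c1 * wz_term x y d a.+1 n a.+1).
  rewrite -(eq_bigr _ (fun i _ => wz_pair x y d n (leq_ord i))).
  by rewrite big_split sumrB -!mulr_sumr /= -/c1 -/c2 -/c3; ring.
under eq_bigr => i _ do rewrite -opprB.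
rewrite sumrN -(big_mkord xpredT
  (fun i => wz_cert x y d a n i.+1 - wz_cert x y d a n i)).
rewrite telescope_sumr // /c1 /wz_cert /wz_term !subnn !expr0 subrr addSn !(exprS q).
rewrite mulr0 !mul0r add0n !qpoch0; ring.
Qed.

(** At n = 0 the factors (q;q)_(i+d) cancel and the series drops to a balanced 3phi2, for which a
    first-order recurrence in [a] exists. The division by q^i is what restricts this step to q !=
    0. *)
Definition saal_cert (x y : K) (d a i : nat) : K :=
  q ^+ a / q ^+ i * (q - s ^+ 2 * q ^+ (i + d)) * (1 - q ^+ i) *
  qpoch q (x * y) (a.+1 - i) / qpoch q q (a.+1 - i) *
  (xpoch q s x i / qpoch q q i) * (xpoch q s y (i + d) / qpoch q (s ^+ 2) (i + d)).

Lemma saal_pair x y d a i : q != 0 -> (i <= a)%N ->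
  (1 - q * q ^+ a) * (1 - s ^+ 2 * q ^+ (a + d)) * wz_term x y d a.+1 0 i
  - (1 + s * x * q ^+ (a + d)) * (1 + s * y * q ^+ a) * wz_term x y d a 0 i
  = saal_cert x y d a i - saal_cert x y d a i.+1.
Proof.
move=> q0 /subnKC <-; move: (a - i)%N => m {a}.
rewrite /wz_term /saal_cert subSS addn0.
have -> : ((i + m).+1 - i = m.+1)%N by lia.
have -> : ((i + m) - i = m)%N by lia.
rewrite ?addSn !qpochS !xpochS !(exprS q) !(exprD q).
have := q_ok m; have := q_ok i; have := s_ok (i + d).
have := qpoch_qq_neq0 i; have := qpoch_qq_neq0 m.
have := qpoch_qq_neq0 (i + d).
have := qpoch_ss_neq0 (i + d).
have := expf_neq0 i q0.
rewrite !(exprD q).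
move: (qpoch q q i) (qpoch q q m) (qpoch q q (i + d)) (qpoch q (s ^+ 2) _).
move: (qpoch q _ m) (xpoch _ _ _ _) (xpoch _ _ _ _).
move: (q ^+ i) (q ^+ m) (q ^+ d).
move=> Y M D A2 A3 A4 A5 A6 A7 A8 h1 h2 h3 h4 h5 h6 h7 h8.
by field; rewrite ?expr2 in h6 *; rewrite ?q0 ?h1 ?h2 ?h3 ?h4 ?h5 ?h6 ?h7 ?h8.
Qed.

Lemma saal_rec x y d a : q != 0 ->
  (1 - q * q ^+ a) * (1 - s ^+ 2 * q ^+ (a + d)) * wz_sum x y d a.+1 0
  = (1 + s * x * q ^+ (a + d)) * (1 + s * y * q ^+ a) * wz_sum x y d a 0.
Proof.
move=> q0; rewrite /wz_sum (big_ord_recr a.+1) /= mulrDr.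
set c1 := (X in X * _ + _); set c2 := (X in _ = X * _).
apply/eqP; rewrite -subr_eq0; apply/eqP.
transitivity (\sum_(i < a.+1) (saal_cert x y d a i - saal_cert x y d a i.+1)
              + c1 * wz_term x y d a.+1 0 a.+1).
  rewrite -(eq_bigr _ (fun i _ => saal_pair x y d q0 (leq_ord i))).
  by rewrite sumrB -!mulr_sumr /= -/c1 -/c2; ring.
under eq_bigr => i _ do rewrite -opprB.
rewrite sumrN -(big_mkord xpredT
  (fun i => saal_cert x y d a i.+1 - saal_cert x y d a i)).
rewrite telescope_sumr // /c1 /saal_cert /wz_term !subnn !expr0 subrr addSn !(exprS q).
rewrite addn0 mulr0 !mul0r !qpoch0.
have := qpoch_qq_neq0 (a + d).+1; have := qpoch_qq_neq0 a.+1.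
have := qpoch_ss_neq0 (a + d).+1; have := expf_neq0 a q0.
move=> h1 h2 h3 h4.
by field; rewrite q0 h1 h2 h3 h4.
Qed.

(** The prefactor is [gw x mu t * gw y nu t] in the coordinates of [wz_term]. *)
Definition sears_sum x y d a n :=
  qpoch q (- (s * x)) (n + d) * qpoch q (- (s * y)) n /
    (qpoch q q (n + d) * qpoch q q n) * wz_sum x y d a n.

Lemma sears_sum_rec x y d a n :
  q ^+ n * (1 - q * q ^+ a) * (1 - q * q ^+ (a + d)) * sears_sum x y d a.+1 n
  = q ^+ a * (1 - q * q ^+ n) * (1 - q * q ^+ (n + d)) * sears_sum x y d a n.+1
  - (q ^+ a - q ^+ n) * (1 - x * y * (q * q ^+ (a + n + d))) * sears_sum x y d a n.
Proof.
apply/eqP; rewrite -subr_eq0; apply/eqP.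
rewrite /sears_sum addSn !qpochS.
have := qpoch_qq_neq0 (n + d); have := qpoch_qq_neq0 n.
have := q_ok n; have := q_ok (n + d).
move=> h1 h2 h3 h4.
transitivity (qpoch q (- (s * x)) (n + d) * qpoch q (- (s * y)) n /
    (qpoch q q (n + d) * qpoch q q n) * 0); last by rewrite mulr0.
rewrite -(wz_rec x y d a n); field.
by rewrite h1 h2 h3 h4.
Qed.

(** Both sides satisfy the same first-order recurrence in [a]; on the right the inner sum has a
    single term, so the recurrence is read off directly. *)
Lemma sears_sum_saal x y d a : q != 0 -> sears_sum x y d a 0 = sears_sum x y d 0 a.
Proof.
move=> q0; elim: a => [//|a IH].
have h1 := qpoch_qq_neq0 d; have h2 := q_ok a; have h3 := s_ok (a + d).
have h4 := q_ok (a + d).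
have h5 := qpoch_qq_neq0 (a + d); have h6 := qpoch_qq_neq0 a.
have h7 := qpoch_ss_neq0 (a + d).
apply: (mulfI h2); apply: (mulfI h3).
transitivity ((1 + s * x * q ^+ (a + d)) * (1 + s * y * q ^+ a) * sears_sum x y d a 0).
  rewrite /sears_sum add0n !qpoch0 !mulr1.
  have E := saal_rec x y d a q0.
  set P := _ / _; rewrite [RHS]mulrCA -E; ring.
rewrite IH /sears_sum /wz_sum !big_ord1 /wz_term !addSn !add0n !(addnC d) ?addSn.
rewrite !qpochS !qpoch0 !xpoch0.
by field; rewrite ?expr2 in h3 *; rewrite h1 h2 h3 h4 h5 h6 h7.
Qed.

(* The leading coefficient of [sears_sum_rec] vanishes at [q = 0], which is
   treated apart. *)
Lemma sears_sum_sym_qneq0 x y d a n : q != 0 -> sears_sum x y d a n = sears_sum x y d n a.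
Proof.
move=> q0; elim: a n => [|a IH] n; first by rewrite sears_sum_saal.
have c0 : q ^+ n * (1 - q * q ^+ a) * (1 - q * q ^+ (a + d)) != 0.
  by rewrite !mulf_neq0 ?expf_neq0.
apply: (mulfI c0); rewrite sears_sum_rec IH (IH n).
(* The recurrence with [a] and [n] exchanged involves the same three coefficients, and it evaluates
   the combination left by the induction hypothesis. *)
have := sears_sum_rec x y d n a; rewrite [(n + a)%N]addnC => /eqP.
rewrite -subr_eq0 => /eqP E.
by rewrite -[RHS]addr0 -{}E; ring.
Qed.

(** * The degenerate case q = 0 *)

Lemma xpoch_q0 (x : K) m : q = 0 -> xpoch q s x m.+1 = (x + s) * x ^+ m.
Proof.
move=> q0; elim: m => [|m IH].
  by rewrite xpochS xpoch0 !expr0; ring.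
by rewrite xpochS IH q0 exprS exprSr; ring.
Qed.

Lemma qpoch_q0 (a : K) m : q = 0 -> qpoch q a m.+1 = 1 - a.
Proof.
move=> q0; elim: m => [|m IH]; first by rewrite qpochS qpoch0 !expr0; ring.
by rewrite qpochS IH q0 exprS; ring.
Qed.

Lemma qpoch_qq_q0 m : q = 0 -> qpoch q q m = 1.
Proof. by move=> q0; case: m => [|m]; rewrite ?qpoch0 // qpoch_q0 // q0 subr0. Qed.

(** At q = 0 the symbol (z;q)_j is 1 - z for j > 0 and 1 for j = 0: the sum telescopes, and its last
    term z^m completes it to 1. *)
Lemma geom_q0 (z : K) m : q = 0 ->
  \sum_(j < m.+1) z ^+ j * qpoch q z (m - j) = 1.
Proof.
move=> q0; elim: m => [|m IH]; first by rewrite big_ord1 subnn qpoch0 mulr1.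
rewrite big_ord_recl subn0 qpoch_q0 // expr0 mul1r.
under eq_bigr => i _ do rewrite /= subSS exprS -mulrA.
by rewrite -mulr_sumr IH; ring.
Qed.

(** The value no longer depends on [a], so for a, n > 0 the symmetry is immediate and only the
    boundary cases remain. *)
Lemma wz_sum_q0 x y d a n : q = 0 ->
  wz_sum x y d a.+1 n = (1 - x * y) * xpoch q s y d / qpoch q (s ^+ 2) (d + n)
     + (x + s) * (y + s) * y ^+ d / (1 - s ^+ 2).
Proof.
move=> q0; rewrite /wz_sum big_ord_recl /wz_term subn0 !qpoch_qq_q0 // qpoch_q0 //.
rewrite xpoch0 !add0n; congr (_ + _); first by rewrite !invr1; ring.
transitivity ((x + s) * (y + s) * y ^+ d / (1 - s ^+ 2)
  * \sum_(j < a.+1) (x * y) ^+ j * qpoch q (x * y) (a - j)); last first.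
  by rewrite geom_q0 // mulr1.
rewrite mulr_sumr; apply: eq_bigr => i _.
rewrite lift0 subSS !addSn !qpoch_qq_q0 // !qpoch_q0 // !xpoch_q0 //.
rewrite exprMn exprD !invr1. ring.
Qed.

Lemma sears_sum_sym x y d a n : sears_sum x y d a n = sears_sum x y d n a.
Proof.
have [q0|q0] := eqVneq q 0; last exact: sears_sum_sym_qneq0.
have h1 := s_ok 0; rewrite expr0 mulr1 in h1.
have base m : sears_sum x y d m.+1 0 = sears_sum x y d 0 m.+1.
  rewrite /sears_sum wz_sum_q0 // /wz_sum big_ord1 /wz_term subnn !qpoch_qq_q0 //.
  rewrite !addn0 !addSn !addnS !(qpoch_q0 _ _ q0) !qpoch0 xpoch0 !add0n.
  case: d => [|d].
    by rewrite !qpoch0 xpoch0; field; rewrite expr2 in h1 *.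
  by rewrite !qpoch_q0 // xpoch_q0 // (exprS y); field; rewrite expr2 in h1 *.
case: a => [|a]; case: n => [|n]; rewrite ?base //.
by rewrite /sears_sum !wz_sum_q0 // !qpoch_qq_q0 // !addnS !addSn !(qpoch_q0 _ _ q0).
Qed.

(* Set to 0 for [a < b], so that a nonzero product of these factors forces
   interlacing and sums over sequences need no side condition. *)
Definition fw (x : K) (a b : nat) : K :=
  if (b <= a)%N then xpoch q s x (a - b) / qpoch q q (a - b) else 0.
Definition gw (x : K) (a b : nat) : K :=
  if (b <= a)%N then qpoch q (- (s * x)) (a - b) / qpoch q q (a - b) else 0.
Definition bw (a b : nat) : K :=
  if (b <= a)%N then qpoch q q (a - b) / qpoch q (s ^+ 2) (a - b) else 0.
Definition phw (z : K) (a b : nat) : K :=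
  if (b <= a)%N then qpoch q z (a - b) / qpoch q q (a - b) else 0.

(** Here mu = t + n + d, nu = t + n and k = t + n + d + a; the terms with N < mu vanish through
    [fw x N mu]. *)
Lemma sears_sum_left x y d n t a :
  gw x (t + n + d) t * gw y (t + n) t *
    \sum_(N < (t + n + d + a).+1) phw (x * y) (t + n + d + a) N *
      fw x N (t + n + d) * fw y N (t + n) * bw N t = sears_sum x y d a n.
Proof.
rewrite /sears_sum /gw ifT ?ifT; [|lia|lia].
rewrite -addnA !addKn -addnS big_split_ord /= big1 ?add0r => [|i _]; last first.
  by rewrite /fw; have := ltn_ord i; case: leqP; [lia|rewrite mulr0 !mul0r].
rewrite [(t + (n + d))%N]addnA.
congr (_ * _); first by field; rewrite !qpoch_qq_neq0.
apply: eq_bigr => i _; rewrite /wz_term /phw /fw /bw.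
have := ltn_ord i; rewrite ltnS => ia.
rewrite !ifT; [|lia..].
have -> : (t + n + d + a - (t + n + d + i) = a - i)%N by lia.
have -> : (t + n + d + i - (t + n + d) = i)%N by lia.
have -> : (t + n + d + i - (t + n) = i + d)%N by lia.
by have -> : (t + n + d + i - t = i + d + n)%N by lia.
Qed.

(** In the same coordinates the factors confine [ka] to the interval from t to nu. Reversing it, ka
    = nu - i, produces [wz_term] with [a] and [n] exchanged. *)
Lemma sears_sum_right x y d n t a :
  gw x (t + n + d + a) (t + n) * gw y (t + n + d + a) (t + n + d) *
    \sum_(ka < (t + n + d + a).+1) bw (t + n + d + a) ka *
      fw x (t + n) ka * fw y (t + n + d) ka * phw (x * y) ka t = sears_sum x y d n a.
Proof.
rewrite /sears_sum /gw ifT ?ifT; [|lia|lia].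
have -> : (t + n + d + a - (t + n) = a + d)%N by lia.
have -> : (t + n + d + a - (t + n + d) = a)%N by lia.
congr (_ * _); first by field; rewrite !qpoch_qq_neq0.
have -> : ((t + n + d + a).+1 = t + (n.+1 + (d + a)))%N by lia.
rewrite big_split_ord /= big1 ?add0r => [|i _]; last first.
  by rewrite /phw; have := ltn_ord i; case: leqP; [lia|rewrite mulr0].
rewrite big_split_ord /= [X in _ + X]big1 ?addr0 => [|i _]; last first.
  by rewrite /fw ifF ?mulr0 ?mul0r //; apply/negbTE; rewrite -ltnNge; lia.
rewrite (reindex_inj rev_ord_inj) /=; apply: eq_bigr => i _.
have := ltn_ord i; rewrite ltnS => ia; rewrite subSS.
rewrite /wz_term /phw /fw /bw !ifT; [|lia..].
have -> : (t + n + d + a - (t + (n - i)) = i + d + a)%N by lia.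
have -> : (t + n - (t + (n - i)) = i)%N by lia.
have -> : (t + n + d - (t + (n - i)) = i + d)%N by lia.
have -> : (t + (n - i) - t = n - i)%N by lia.
by ring.
Qed.

Lemma crossing_le x y mu nu k t : (nu <= mu)%N ->
  gw x mu t * gw y nu t *
    \sum_(N < k.+1) phw (x * y) k N * fw x N mu * fw y N nu * bw N t
  = gw x k nu * gw y k mu *
    \sum_(ka < k.+1) bw k ka * fw x nu ka * fw y mu ka * phw (x * y) ka t.
Proof.
move=> le_numu.
(* If t > nu or k < mu, both sides are 0: on one side a [gw] factor in front vanishes, on the other
   the constraints inside the sum are incompatible. *)
have [le_t|lt_t] := leqP t nu; last first.
  rewrite [gw y nu t]/gw leqNgt lt_t mulr0 mul0r.
  rewrite big1 ?mulr0 // => i _; rewrite /fw /phw.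
  have [le_ti|_] := leqP t i; last by rewrite mulr0.
  have [le_inu|_] := leqP i nu; last by rewrite mulr0 !mul0r.
  by move: (leq_trans le_ti le_inu); rewrite leqNgt lt_t.
have [le_k|lt_k] := leqP mu k; last first.
  rewrite [gw y k mu]/gw leqNgt lt_k mulr0 mul0r.
  rewrite big1 ?mulr0 // => i _; rewrite /fw.
  by rewrite leqNgt (leq_ltn_trans (leq_ord i) lt_k) mulr0 !mul0r.
rewrite -(subnKC le_k) -(subnKC le_numu) -(subnKC le_t).
by rewrite sears_sum_left sears_sum_right sears_sum_sym.
Qed.

(* Used with [mu = mu_c], [nu = nu_c], [t = la_(c+1)] and [k = ka_(c-1)]. *)
Lemma crossing x y mu nu k t M : (k <= M)%N ->
  gw x mu t * gw y nu t *
    \sum_(N < M.+1) phw (x * y) k N * fw x N mu * fw y N nu * bw N t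
  = gw x k nu * gw y k mu *
    \sum_(ka < M.+1) bw k ka * fw x nu ka * fw y mu ka * phw (x * y) ka t.
Proof.
(* The terms beyond k are 0. A range independent of k is needed in [zip_columns], where k itself
   becomes a summation variable. *)
move=> kM; rewrite -(subnKC kM) -addSn !big_split_ord /=.
rewrite [X in _ * (_ + X) = _]big1 ?addr0 => [|i _]; last first.
  by rewrite /phw ifF ?mul0r // addSn leqNgt ltnS leq_addr.
rewrite [X in _ = _ * (_ + X)]big1 ?addr0 => [|i _]; last first.
  by rewrite /bw ifF ?mul0r // addSn leqNgt ltnS leq_addr.
(* The relation is invariant under exchanging x with y together with mu with nu. *)
have [le|/ltnW le] := leqP nu mu; first exact: crossing_le.
rewrite [gw x mu t * _]mulrC [gw x k nu * _]mulrC.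
under eq_bigr => i _ do rewrite mulrAC [x * y]mulrC (mulrAC _ (fw x _ _)) (mulrAC _ (bw _ _)).
under [in RHS]eq_bigr => i _ do rewrite (mulrAC _ (fw x _ _)) [x * y]mulrC.
by rewrite -crossing_le //; congr (_ * _); apply: eq_bigr => i _; ring.
Qed.

(** * Exchange through all columns *)

Fixpoint seqs_le (n k : nat) : seq (seq nat) :=
  if n is n'.+1 then [seq l :: t | l <- iota 0 k.+1, t <- seqs_le n' k]
  else [:: [::]].

Lemma big_seqs_le0 k (F : seq nat -> K) : \sum_(t <- seqs_le 0 k) F t = F [::].
Proof. by rewrite big_seq1. Qed.

Lemma big_seqs_leS n k (F : seq nat -> K) :
  \sum_(t <- seqs_le n.+1 k) F t = \sum_(l < k.+1) \sum_(t <- seqs_le n k) F ((l : nat) :: t).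
Proof.
rewrite big_allpairs_dep /= -(big_mkord xpredT
  (fun l => \sum_(t <- seqs_le n k) F (l :: t))).
by rewrite /index_iota subn0.
Qed.

(** The summand for the pair of one-row weights, grouped by columns. The [bw] factors occur once and
    not twice because the dual normalisation cancels one copy. [la] may have one part more than [mu]
    and [nu], hence the range [n.+1]. *)
Definition up_weight x y n (mu nu la : seq nat) : K :=
  fw x (entry la 0) (entry mu 0) * fw y (entry la 0) (entry nu 0) *
  \prod_(c < n.+1)
    (gw x (entry mu c) (entry la c.+1) * gw y (entry nu c) (entry la c.+1) *
     bw (entry la c) (entry la c.+1) *
     (fw x (entry la c.+1) (entry mu c.+1) * fw y (entry la c.+1) (entry nu c.+1))).

Definition down_weight x y n (mu nu ka : seq nat) : K :=
  \prod_(c < n)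
    (fw x (entry nu c) (entry ka c) * fw y (entry mu c) (entry ka c) *
     (gw x (entry ka c) (entry nu c.+1) * gw y (entry ka c) (entry mu c.+1) *
      bw (entry ka c) (entry ka c.+1))).

Lemma up_weightS x y n m0 n0 l mu nu la :
  up_weight x y n.+1 (m0 :: mu) (n0 :: nu) (l :: la) =
  fw x l m0 * fw y l n0 * (gw x m0 (entry la 0) * gw y n0 (entry la 0) * bw l (entry la 0)) *
  up_weight x y n mu nu la.
Proof. by rewrite /up_weight big_ord_recl /=; ring. Qed.

Lemma down_weightS x y n m0 n0 l mu nu ka :
  down_weight x y n.+1 (m0 :: mu) (n0 :: nu) (l :: ka) =
  fw x n0 l * fw y m0 l * (gw x l (entry nu 0) * gw y l (entry mu 0) * bw l (entry ka 0)) *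
  down_weight x y n mu nu ka.
Proof. by rewrite /down_weight big_ord_recl /=; ring. Qed.

Lemma fw00 x : fw x 0 0 = 1.
Proof. by rewrite /fw /= qpoch0 xpoch0 divr1. Qed.

Lemma gw00 x : gw x 0 0 = 1.
Proof. by rewrite /gw /= !qpoch0 divr1. Qed.

Lemma bw00 : bw 0 0 = 1.
Proof. by rewrite /bw /= !qpoch0 divr1. Qed.

Lemma phw00 z : phw z 0 0 = 1.
Proof. by rewrite /phw /= !qpoch0 divr1. Qed.

Lemma zip_columns x y n k M (mu nu : seq nat) : (k <= M)%N ->
  size mu = n -> size nu = n ->
  \sum_(la <- seqs_le n.+1 M) phw (x * y) k (entry la 0) * up_weight x y n mu nu la
  = gw x k (entry nu 0) * gw y k (entry mu 0) *
    \sum_(ka <- seqs_le n M) bw k (entry ka 0) * down_weight x y n mu nu ka.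
Proof.
elim: n k mu nu => [|n IH] k mu nu kM.
  move=> /size0nil -> /size0nil ->; rewrite big_seqs_leS big_seqs_le0.
  (* Past the last parts mu = nu = t = 0, and [fw x 0 ka] leaves only ka = 0: the exchanged factor
     disappears. *)
  have E := crossing x y 0 0 0 kM; rewrite !gw00 !mul1r in E.
  rewrite /down_weight big_ord0 /= mulr1.
  transitivity (\sum_(N < M.+1) phw (x * y) k N * fw x N 0 * fw y N 0 * bw N 0).
    apply: eq_bigr => l _; rewrite big_seq1 /up_weight big_ord1 /=.
    by rewrite !gw00 !fw00; ring.
  rewrite E big_ord_recl big1 => [|i _]; last by rewrite /fw /= mulr0 !mul0r.
  by rewrite !fw00 phw00; ring.
case: mu => // m0 mu; case: nu => // n0 nu [smu] [snu].
rewrite big_seqs_leS exchange_big /=.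
transitivity (\sum_(la <- seqs_le n.+1 M) up_weight x y n mu nu la *
   (gw x m0 (entry la 0) * gw y n0 (entry la 0) *
    \sum_(N < M.+1) phw (x * y) k N * fw x N m0 * fw y N n0 * bw N (entry la 0))).
  apply: eq_bigr => la _; rewrite mulrA mulr_sumr; apply: eq_bigr => l _.
  by rewrite up_weightS; ring.
transitivity (\sum_(la <- seqs_le n.+1 M) gw x k n0 * gw y k m0 *
   \sum_(ka < M.+1) up_weight x y n mu nu la *
     (bw k ka * fw x n0 ka * fw y m0 ka * phw (x * y) ka (entry la 0))).
  by apply: eq_bigr => la _; rewrite crossing // mulrCA mulr_sumr.
rewrite -mulr_sumr exchange_big /=; congr (_ * _).
rewrite big_seqs_leS; apply: eq_bigr => ka _.
(* The part [ka] just created takes the place of k for the remaining columns. *)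
transitivity (bw k ka * fw x n0 ka * fw y m0 ka *
   \sum_(la <- seqs_le n.+1 M) phw (x * y) ka (entry la 0) * up_weight x y n mu nu la).
  by rewrite mulr_sumr; apply: eq_bigr => la _; ring.
rewrite IH ?leq_ord // mulrA mulr_sumr; apply: eq_bigr => t _.
by rewrite down_weightS /=; ring.
Qed.

End FiniteIdentity.

(** * Unconditional sums *)

Section Sums.
Variable K : numFieldType.
Implicit Types I J : choiceType.

(** Sums run over the whole index type, the domain being encoded in the support of [f];
    [sums_to_has_sum] restores it at the end. *)
Definition sums_to I (f : I -> K) (l : K) :=
  forall e : K, 0 < e -> exists A0 : {fset I}, forall A : {fset I},
    A0 `<=` A -> `|l - \sum_(i <- A) f i| <= e.

Lemma sums_to_has_sum I (D : set I) f l :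
  (forall i, f i != 0 -> D i) -> sums_to f l -> has_sum D f l.
Proof.
move=> fD fl; have FF := @summability.totally_filter I.
apply/cvgrPdist_le => e e0.
have [A0 hA0] := fl e e0; exists A0 => // A /= A0A.
rewrite big_mkcond /=; under eq_bigr => i _.
  rewrite (_ : (if _ then _ else _) = f i); first over.
  case: ifPn => //; rewrite notin_setE => nDi.
  by apply/eqP; rewrite eq_sym; apply: contra_notT nDi; exact: fD.
exact: hA0.
Qed.

Lemma sums_to_ext I (f g : I -> K) l : f =1 g -> sums_to f l -> sums_to g l.
Proof. by move=> /funext ->. Qed.

Lemma sums_toD I (f g : I -> K) l m :
  sums_to f l -> sums_to g m -> sums_to (fun i => f i + g i) (l + m).
Proof.
move=> fl gm e e0; have e2 : 0 < e / 2 by rewrite divr_gt0.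
have [A hA] := fl _ e2; have [B hB] := gm _ e2; exists (A `|` B) => C.
rewrite fsubUset => /andP[AC BC]; rewrite big_split /= opprD addrACA.
by rewrite (le_trans (ler_normD _ _)) // (splitr e) lerD ?hA ?hB.
Qed.

Lemma sums_toZ I (f : I -> K) l c :
  sums_to f l -> sums_to (fun i => c * f i) (c * l).
Proof.
move=> fl e e0; have c1 : 0 < `|c| + 1 by rewrite ltr_wpDl.
have [A hA] := fl _ (divr_gt0 e0 c1); exists A => B AB.
rewrite -mulr_sumr -mulrBr normrM (le_trans (ler_wpM2l _ (hA B AB))) //.
by rewrite mulrCA ler_piMr ?(ltW e0)// ler_pdivrMr // mul1r lerDl.
Qed.

Lemma sums_to0 I : sums_to (fun _ : I => 0) 0.
Proof. by move=> e e0; exists fset0 => A _; rewrite big1 // subr0 normr0 ltW. Qed.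

Lemma sums_to_sum I J (s : seq J) (f : J -> I -> K) l :
  (forall j, sums_to (f j) (l j)) ->
  sums_to (fun i => \sum_(j <- s) f j i) (\sum_(j <- s) l j).
Proof.
move=> fl; elim: s => [|j s IH].
  by rewrite big_nil; apply: sums_to_ext (@sums_to0 I) => i; rewrite big_nil.
rewrite big_cons; apply: sums_to_ext (sums_toD (fl j) IH) => i.
by rewrite big_cons.
Qed.

Lemma big_fset_split I (A B : {fset I}) (f : I -> K) : A `<=` B ->
  \sum_(i <- B) f i = \sum_(i <- A) f i + \sum_(i <- B `\` A) f i.
Proof.
move=> AB; rewrite -big_cat /=; apply: perm_big; apply: uniq_perm => //.
  rewrite cat_uniq !fset_uniq /= andbT; apply/hasPn => i.
  by rewrite /= in_fsetD => /andP[].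
move=> i; rewrite mem_cat in_fsetD; case: (boolP (i \in A)) => //= iA.
by rewrite (fsubsetP AB).
Qed.

Lemma big_fset_supp I (A B : {fset I}) (f : I -> K) : A `<=` B ->
  (forall i, i \in B -> i \notin A -> f i = 0) ->
  \sum_(i <- B) f i = \sum_(i <- A) f i.
Proof.
move=> AB f0; rewrite (big_fset_split _ AB) -[RHS]addr0; congr (_ + _).
rewrite big_seq big1 // => i.
by rewrite in_fsetD => /andP[iA iB]; exact: f0.
Qed.

Lemma sums_to_fin I (A : {fset I}) (f : I -> K) :
  (forall i, i \notin A -> f i = 0) -> sums_to f (\sum_(i <- A) f i).
Proof.
move=> f0 e e0; exists A => B AB.
by rewrite (big_fset_supp AB) ?subrr ?normr0 ?ltW // => i _; exact: f0.
Qed.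

Lemma ler_sum_fset I (A B : {fset I}) (f : I -> K) : A `<=` B ->
  (forall i, 0 <= f i) -> \sum_(i <- A) f i <= \sum_(i <- B) f i.
Proof. by move=> AB f0; rewrite (big_fset_split _ AB) lerDl sumr_ge0. Qed.

Definition small_tails I (f : I -> K) :=
  forall e : K, 0 < e -> exists A0 : {fset I}, forall A : {fset I},
    A0 `<=` A -> \sum_(i <- A `\` A0) `|f i| <= e.

Lemma cvg_sum_seq I (s : seq I) (f : nat -> I -> K) (l : I -> K) :
  (forall i, f^~ i @ \oo --> l i) ->
  (fun n => \sum_(i <- s) f n i : K) @ \oo --> (\sum_(i <- s) l i : K).
Proof.
move=> fl; elim: s => [|i s IH].
  by rewrite big_nil; under eq_fun do rewrite big_nil; exact: cvg_cst.
rewrite big_cons; under eq_fun do rewrite big_cons; exact: cvgD.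
Qed.

(** Dominated convergence used backwards: the weighted finite sums are known, and the sum of [t] is
    deduced from their limit. *)
Lemma sums_to_weighted_limit I (t : I -> K) (B : nat -> {fset I}) (w : nat -> I -> K)
    (C w0 V : K) (v : nat -> K) :
  small_tails t ->
  (forall A : {fset I}, \forall n \near \oo, A `<=` B n) ->
  0 <= C -> (forall n i, `|w n i| <= C) ->
  (forall i, w^~ i @ \oo --> w0) ->
  (\forall n \near \oo, \sum_(i <- B n) w n i * t i = v n) ->
  v @ \oo --> V -> w0 != 0 ->
  sums_to t (V / w0).
Proof.
move=> tM AB C0 wC ww vE vV w00.
suff h : sums_to (fun i => w0 * t i) V.
  rewrite mulrC; apply: sums_to_ext (sums_toZ w0^-1 h) => i.
  by rewrite mulKf.
move=> e' e0'.
have D0 : 0 < C + `|w0| + 2 by rewrite ltr_wpDl // addr_ge0.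
(* Four errors are added below: e for the limit of [v], e for the weights on [A0], C e and |w0| e
   for the two tails outside [A0]. *)
pose e := e' / (C + `|w0| + 2).
have e0 : 0 < e by rewrite divr_gt0.
have [A0 hA0] := tM _ e0; exists A0 => A AA.
have S0 : (fun n => \sum_(i <- A0) (w0 - w n i) * t i : K) @ \oo --> (0 : K).
  have H i : (fun n => (w0 - w n i) * t i) @ \oo --> (w0 - w0) * t i.
    by apply: cvgMr_tmp; apply: cvgB; [exact: cvg_cst|exact: ww].
  have := @cvg_sum_seq _ A0 _ _ H; rewrite [X in _ --> X]big1 // => i _.
  by rewrite subrr mul0r.
have [n [A0B vn Sn Vn]] : exists n, [/\ A0 `<=` B n, \sum_(i <- B n) w n i * t i = v n,
    `|\sum_(i <- A0) (w0 - w n i) * t i| <= e & `|V - v n| <= e].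
  move/cvgrPdist_le : S0 => /(_ e e0) S0; move/cvgrPdist_le : vV => /(_ e e0) vV.
  near \oo%classic => n; exists n; split; near: n => //.
  by apply: filterS S0 => n; rewrite sub0r normrN.
rewrite -mulr_sumr.
have -> : V - w0 * \sum_(i <- A) t i = (V - v n) - \sum_(i <- A0) (w0 - w n i) * t i
   + \sum_(i <- B n `\` A0) w n i * t i - w0 * \sum_(i <- A `\` A0) t i.
  rewrite (big_fset_split _ AA) -vn (big_fset_split _ A0B).
  have -> : \sum_(i <- A0) (w0 - w n i) * t i =
      w0 * \sum_(i <- A0) t i - \sum_(i <- A0) w n i * t i.
    by rewrite mulr_sumr -sumrB; apply: eq_bigr => i _; rewrite mulrBl.
  by ring.
have -> : e' = e + e + C * e + `|w0| * e.
  by rewrite /e; field; exact: lt0r_neq0.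
rewrite (le_trans (ler_normB _ _)) // lerD //; last first.
  rewrite normrM ler_wpM2l // (le_trans (ler_norm_sum _ _ _)) //; exact: hA0.
rewrite (le_trans (ler_normD _ _)) // lerD //.
  by rewrite (le_trans (ler_normB _ _)) // lerD.
rewrite (le_trans (ler_norm_sum _ _ _)) //.
apply: (@le_trans _ _ (C * \sum_(i <- B n `\` A0) `|t i|)).
  by rewrite mulr_sumr; apply: ler_sum => i _; rewrite normrM ler_wpM2r.
by rewrite ler_wpM2l // hA0.
Unshelve. all: by end_near.
Qed.

End Sums.

(** * Absolute summability and Fubini over the complex numbers *)

Section ComplexSums.
Variable R : realType.
Local Notation K := R[i].
Implicit Types I J : choiceType.

(** The order on [R[i]] is partial, so the supremum is taken in [R]: being comparable with 0 makes
    all the values real, and [t0] does the same for [M]. *)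
Lemma near_sup (T : Type) (F : T -> K) (M e : K) (t0 : T) :
  (forall t, 0 <= F t <= M) -> 0 < e -> exists t, forall u, F u <= F t + e.
Proof.
move=> FM e0.
have FE t : F t = (complex.Re (F t))%:C%C.
  by have /andP[h _] := FM t; rewrite RRe_real // ger0_real.
have eE : e = (complex.Re e)%:C%C by rewrite RRe_real // gtr0_real.
have ME : M = (complex.Re M)%:C%C.
  have /andP[h1 h2] := FM t0.
  by rewrite RRe_real // ger0_real // (le_trans h1).
pose S := [set complex.Re (F t) | t in [set: T]].
have hS : has_sup S.
  split; first by exists (complex.Re (F t0)), t0.
  exists (complex.Re M) => _ [t _ <-]; have /andP[_] := FM t.
  by rewrite FE ME lecR.
have e0' : 0 < complex.Re e by move: e0; rewrite eE ltcR.
have [_ [t _ <-] ht] := sup_adherent e0' hS; exists t => u.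
rewrite (FE t) (FE u) eE -rmorphD lecR -lerBlDr; apply: ltW; apply: le_lt_trans ht.
by rewrite lerB // sup_upper_bound //; exists u.
Qed.

Lemma bounded_small_tails I (f : I -> K) (M : K) :
  (forall A : {fset I}, \sum_(i <- A) `|f i| <= M) -> small_tails f.
Proof.
move=> fM e e0.
have FM (A : {fset I}) : 0 <= \sum_(i <- A) `|f i| <= M by rewrite fM sumr_ge0.
have [A0 hA0] := near_sup fset0 FM e0; exists A0 => A AA.
by have := hA0 A; rewrite (big_fset_split _ AA) lerD2l.
Qed.

(** A nearly maximal rectangle [A0] x [B0] carries all the mass up to e, so enlarging B to C adds at
    most e, uniformly in A and C. *)
Lemma small_tail2 I J (a : I -> J -> K) (M e : K) :
  (forall (A : {fset I}) (B : {fset J}),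
     \sum_(i <- A) \sum_(j <- B) `|a i j| <= M) -> 0 < e ->
  exists (A0 : {fset I}) (B0 : {fset J}), forall A B C,
    A0 `<=` A -> B0 `<=` B -> B `<=` C ->
    \sum_(i <- A) \sum_(j <- C `\` B) `|a i j| <= e.
Proof.
move=> fM e0.
have FM (p : {fset I} * {fset J}) :
    0 <= \sum_(i <- p.1) \sum_(j <- p.2) `|a i j| <= M.
  by rewrite fM sumr_ge0 // => i _; rewrite sumr_ge0.
have [[A0 B0] h] := near_sup (fset0, fset0) FM e0.
exists A0, B0 => A B C AA BB BC; have := h (A, C) => /=.
under eq_bigr => i _ do rewrite (big_fset_split _ BC).
rewrite big_split /= => h'; rewrite -(lerD2l (\sum_(i <- A) \sum_(j <- B) `|a i j|)).
apply: le_trans h' _; rewrite lerD2r.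
apply: (@le_trans _ _ (\sum_(i <- A0) \sum_(j <- B) `|a i j|)).
  by apply: ler_sum => i _; apply: ler_sum_fset.
by apply: ler_sum_fset => // i; rewrite sumr_ge0.
Qed.

Lemma sums_to_exchange I J (a : I -> J -> K) (M : K) r c V :
  (forall (A : {fset I}) (B : {fset J}),
     \sum_(i <- A) \sum_(j <- B) `|a i j| <= M) ->
  (forall i, sums_to (a i) (r i)) -> sums_to r V ->
  (forall j, sums_to (a^~ j) (c j)) -> sums_to c V.
Proof.
move=> aM ar rV ac e e0; have e4 : 0 < e / 4%:R by rewrite divr_gt0.
have [A0 [B0 h0]] := small_tail2 aM e4; exists B0 => B BB.
have [A1 h1] := rV _ e4.
have [A2 h2] := sums_to_sum B ac e4.
(* The order of choices matters: [A] depends on [B], then [B1] depends on [A]. The tail over [B1]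
   stays small because [small_tail2] is uniform in the larger set. *)
pose A := A0 `|` A1 `|` A2.
have AA0 : A0 `<=` A by rewrite /A -fsetUA fsubsetUl.
have AA1 : A1 `<=` A by rewrite /A fsetUAC fsubsetUr.
have AA2 : A2 `<=` A by rewrite /A fsubsetUr.
have [B1 h3] := sums_to_sum A ar e4.
have := h3 (B `|` B1) (fsubsetUr _ _); rewrite exchange_big /= => h3'.
have := h1 A AA1 => h1'; have := h2 A AA2 => h2'.
have := h0 A B (B `|` B1) AA0 BB (fsubsetUl _ _) => h0'.
have E : \sum_(i <- A) \sum_(j <- B `|` B1) a i j =
   \sum_(i <- A) \sum_(j <- B) a i j + \sum_(i <- A) \sum_(j <- (B `|` B1) `\` B) a i j.
  rewrite -big_split /=; apply: eq_bigr => i _.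
  by rewrite -big_fset_split // fsubsetUl.
rewrite E in h3'.
set X := \sum_(i <- A) r i in h1' h3'.
set Y := \sum_(i <- A) \sum_(j <- B) a i j in h2' h3'.
set Z := \sum_(i <- A) \sum_(j <- _ `\` _) a i j in h3'.
have hZ : `|Z| <= e / 4%:R.
  apply: le_trans h0'; rewrite (le_trans (ler_norm_sum _ _ _)) //.
  by apply: ler_sum => i _; rewrite (le_trans (ler_norm_sum _ _ _)).
have -> : V - \sum_(j <- B) c j = (V - X) + (X - (Y + Z)) + Z - (\sum_(j <- B) c j - Y).
  by ring.
have -> : e = e / 4%:R + e / 4%:R + e / 4%:R + e / 4%:R by field.
rewrite (le_trans (ler_normB _ _)) // lerD //.
rewrite (le_trans (ler_normD _ _)) // lerD //.
by rewrite (le_trans (ler_normD _ _)) // lerD.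
Qed.

End ComplexSums.

(** * Partitions and the one-row identity *)

Lemma intpart_nth_anti (la : intpart) i j : (i <= j)%N -> (entry la j <= entry la i)%N.
Proof.
move=> ij; have [sj|sj] := leqP (size la) j; first by rewrite nth_default.
have /andP[sla _] := partsP la.
have geq_trans : transitive geq by move=> a b c; lia.
have := sorted_leq_nth geq_trans leqnn 0%N sla.
by apply => //; rewrite inE ?(leq_ltn_trans ij).
Qed.

Lemma intpart_nth_gt0 (la : intpart) i : (0 < entry la i)%N = (i < size la)%N.
Proof.
have [sj|sj] := ltnP i (size la); last by rewrite nth_default.
have /andP[_ z] := partsP la; rewrite lt0n; apply: contraNneq z => <-.
exact: mem_nth.
Qed.

Lemma intpart_eq (la mu : intpart) : entry la =1 entry mu -> la = mu.
Proof.
move=> E; apply: val_inj; apply: (@eq_from_nth _ 0%N) => [|i _]; last exact: E.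
have H i : (i < size la)%N = (i < size mu)%N by rewrite -!intpart_nth_gt0 E.
by apply/eqP; rewrite eqn_leq leqNgt H ltnn leqNgt -H ltnn.
Qed.

Lemma intpart_size_le (la : intpart) n : (size la <= n)%N = (entry la n == 0)%N.
Proof. by rewrite leqNgt -intpart_nth_gt0 lt0n negbK. Qed.

Definition empty_intpart : intpart := IntPart (isT : is_intpart [::]).

(** Removes zero padding; the default of [insubd] can be reached only from unsorted sequences. *)
Definition part_of_seq (t : seq nat) : intpart :=
  insubd empty_intpart [seq p <- t | 0 < p]%N.

Lemma part_of_seqE t : sorted geq t -> part_of_seq t = [seq p <- t | 0 < p]%N :> seq nat.
Proof.
move=> st; rewrite /part_of_seq val_insubd ifT // /is_intpart mem_filter andbT.
by apply: sorted_filter => // a b c; lia.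
Qed.

Lemma nth_part_of_seq t i : sorted geq t -> entry (part_of_seq t) i = entry t i.
Proof.
move=> st; rewrite part_of_seqE //; elim: t st i => // p t IH /= pt i.
have st := path_sorted pt.
case: ltnP => [p0|]; first by case: i => //= i; rewrite IH.
rewrite leqn0 => /eqP p0; have t0 : all (pred1 0%N) t.
  apply/allP => r rt /=; have : all (geq p) t.
    by apply: order_path_min pt => a b c; lia.
  by move=> /allP/(_ r rt); rewrite /= p0 leqn0.
have -> : [seq r <- t | 0 < r]%N = [::].
  apply/eqP; rewrite -(negbK (_ == _)) -has_filter; apply/hasPn => r rt.
  by have /eqP -> := allP t0 r rt.
rewrite nth_nil; case: i => //= i; have [si|si] := ltnP i (size t).
  by have /eqP := allP t0 _ (mem_nth 0%N si).
by rewrite nth_default.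
Qed.

Lemma sorted_geq_mkseq (v : nat -> nat) n :
  (forall c, (v c.+1 <= v c)%N) -> sorted geq (mkseq v n).
Proof.
move=> v_anti; apply/(sortedP 0%N) => i; rewrite size_mkseq => lt_i.
by rewrite !nth_mkseq ?(ltnW lt_i) //=.
Qed.

Lemma exists_intpart (v : nat -> nat) n :
  (forall c, (v c.+1 <= v c)%N) -> (forall c, (n <= c)%N -> v c = 0%N) ->
  exists la : intpart, entry la =1 v.
Proof.
move=> v_anti v0; exists (part_of_seq (mkseq v n)) => i.
rewrite nth_part_of_seq ?sorted_geq_mkseq //.
have [lt_i|le_i] := ltnP i n; first by rewrite nth_mkseq.
by rewrite nth_default ?size_mkseq // v0.
Qed.

Lemma seqs_leS n k :
  seqs_le n.+1 k = [seq l :: t | l <- iota 0 k.+1, t <- seqs_le n k].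
Proof. by []. Qed.

Lemma mem_seqs_le n M t : (t \in seqs_le n M) = (size t == n) && all (leq^~ M) t.
Proof.
elim: n t => [|n IH] [|p t] //.
  by rewrite seqs_leS; apply/negP => /allpairsP [[? ?] [_ _]].
rewrite seqs_leS [size _]/= [all _ _]/= eqSS; apply/idP/idP.
  move=> /allpairsP [[l r] [hl hr [-> ->]]].
  by move: hr hl; rewrite IH mem_iota add0n => /andP[/= -> ->] /=; rewrite ltnS => ->.
move=> /and3P[st pM at_]; apply/allpairsP; exists (p, t).
by rewrite mem_iota IH st at_ add0n.
Qed.

Lemma uniq_seqs_le n M : uniq (seqs_le n M).
Proof.
elim: n => // n IH; rewrite seqs_leS; apply: allpairs_uniq => //; first exact: iota_uniq.
by move=> [a b] [c d] _ _ [-> ->].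
Qed.

Definition box n M : {fset intpart} :=
  [fset part_of_seq t | t in [seq t <- seqs_le n M | sorted geq t]].

Lemma part_of_seq_inj n : {in [pred t : seq nat | sorted geq t & size t == n] &,
  injective part_of_seq}.
Proof.
move=> t u /andP[st /eqP szt] /andP[su /eqP szu] E.
apply: (@eq_from_nth _ 0%N) => [|i _]; first by rewrite szt.
by rewrite -nth_part_of_seq // E nth_part_of_seq.
Qed.

Lemma mem_box n M (la : intpart) :
  (la \in box n M) = (size la <= n)%N && (entry la 0 <= M)%N.
Proof.
apply/imfsetP/andP => /= [[t]|[sla hla]].
  rewrite mem_filter mem_seqs_le => /and3P[st /eqP szt /allP aM] ->; split.
    by rewrite part_of_seqE // size_filter -szt count_size.
  rewrite nth_part_of_seq //; case: t {st szt} aM => //= p t aM.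
  by rewrite aM // mem_head.
have anti c : (entry la c.+1 <= entry la c)%N by exact: intpart_nth_anti.
exists (mkseq (entry la) n); last first.
  apply: intpart_eq => i; rewrite nth_part_of_seq ?sorted_geq_mkseq //.
  have [lt_i|le_i] := ltnP i n; first by rewrite nth_mkseq.
  by rewrite !nth_default ?size_mkseq // (leq_trans sla).
rewrite mem_filter sorted_geq_mkseq //= mem_seqs_le size_mkseq eqxx /=.
apply/allP => _ /mapP[c _ ->]; exact: leq_trans (intpart_nth_anti _ _) hla.
Qed.

(** Removing zeros is a bijection from the sorted sequences of length n with entries at most M onto
    the partitions in the box. *)
Lemma big_box (K : numFieldType) n M (F : seq nat -> K) (G : intpart -> K) :
  (forall t, size t = n -> ~~ sorted geq t -> F t = 0) ->
  (forall t, size t = n -> sorted geq t -> F t = G (part_of_seq t)) ->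
  \sum_(t <- seqs_le n M) F t = \sum_(la <- box n M) G la.
Proof.
move=> F0 FG.
have -> : \sum_(la <- box n M) G la =
    \sum_(la <- [seq part_of_seq t | t <- seqs_le n M & sorted geq t]) G la.
  apply: perm_big; apply: uniq_perm => //.
    rewrite map_inj_in_uniq ?filter_uniq ?uniq_seqs_le // => t u.
    rewrite !mem_filter !mem_seqs_le => /and3P[st szt _] /and3P[su szu _].
    by apply: (@part_of_seq_inj n); rewrite inE ?st ?su.
  by move=> la; apply/imfsetP/mapP => /= [[t]|[t]] ht ->; exists t.
rewrite big_map big_filter [RHS]big_mkcond !big_seq; apply: eq_bigr => t.
rewrite mem_seqs_le => /andP[/eqP szt _]; case: ifP => [st|/negbT st].
  exact: FG.
exact: F0.
Qed.

(** * One-row weights and the truncated one-variable identity *)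

Section RowKernel.
Variables (K : numFieldType) (q s : K).
Hypothesis q_ok : forall i, 1 - q * q ^+ i != 0.
Hypothesis s_ok : forall i, 1 - s ^+ 2 * q ^+ i != 0.

Local Notation fw := (fw q s).
Local Notation gw := (gw q s).
Local Notation bw := (bw q s).
Local Notation phw := (phw q).

Definition row_factor (x : K) (mu la : seq nat) c : K :=
  gw x (entry mu c) (entry la c.+1) * bw (entry la c) (entry la c.+1) *
  fw x (entry la c.+1) (entry mu c.+1).

(** The one-variable [F_{la/mu}(x)]; all factors beyond the longer of the two partitions are 1. *)
Definition row_weight (x : K) (mu la : seq nat) : K :=
  fw x (entry la 0) (entry mu 0) *
  \prod_(c < maxn (size mu) (size la)) row_factor x mu la c.

Lemma prod_stable (f : nat -> K) m n : (m <= n)%N ->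
  (forall c, (m <= c)%N -> f c = 1) -> \prod_(c < m) f c = \prod_(c < n) f c.
Proof.
move=> /subnKC <- f1; rewrite big_split_ord /= [X in _ * X]big1 ?mulr1 // => i _.
by rewrite f1 // leq_addr.
Qed.

Lemma row_weightE x (mu la : seq nat) n : (size mu <= n)%N -> (size la <= n)%N ->
  row_weight x mu la =
  fw x (entry la 0) (entry mu 0) * \prod_(c < n) row_factor x mu la c.
Proof.
move=> smu sla; congr (_ * _); apply: prod_stable; first by rewrite geq_max smu.
move=> c; rewrite geq_max => /andP[hmu hla]; rewrite /row_factor.
by rewrite !nth_default ?leqW // gw00 fw00 bw00 !mulr1.
Qed.

Lemma fw_neq0 x a b : fw x a b != 0 -> (b <= a)%N.
Proof. by rewrite /fw; case: leqP; rewrite ?eqxx. Qed.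

Lemma gw_neq0 x a b : gw x a b != 0 -> (b <= a)%N.
Proof. by rewrite /gw; case: leqP; rewrite ?eqxx. Qed.

Lemma bw_neq0 a b : bw a b != 0 -> (b <= a)%N.
Proof. by rewrite /bw; case: leqP; rewrite ?eqxx. Qed.

Definition subpart (mu la : intpart) := forall c, (entry mu c <= entry la c)%N.

Lemma subpart_size mu la : subpart mu la -> (size mu <= size la)%N.
Proof.
move=> ml; have := ml (size la); rewrite [entry la _]nth_default // leqn0.
by rewrite intpart_size_le.
Qed.

Lemma row_weight_neq0 x (mu la : seq nat) : row_weight x mu la != 0 ->
  forall c, (entry mu c <= entry la c)%N /\ (entry la c.+1 <= entry mu c)%N.
Proof.
rewrite mulf_eq0 negb_or => /andP[/fw_neq0 h0 /prodf_neq0 h] c.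
have H n : (entry la n.+1 <= entry mu n)%N /\ (entry mu n.+1 <= entry la n.+1)%N.
  have [lt_n|] := ltnP n (maxn (size mu) (size la)); last first.
    by rewrite geq_max => /andP[? ?]; rewrite !nth_default // leqW.
  have := h (Ordinal lt_n) isT; rewrite !mulf_eq0 !negb_or.
  by move=> /andP[/andP[/gw_neq0 ? _] /fw_neq0 ?].
by split; [case: c => // c; exact: (H c).2 | exact: (H c).1].
Qed.

Lemma row_weight_subpart x (mu la : intpart) : row_weight x mu la != 0 -> subpart mu la.
Proof. by move=> h c; exact: (row_weight_neq0 h c).1. Qed.

Lemma row_weight_size x (mu la : intpart) : row_weight x mu la != 0 ->
  (size la <= (size mu).+1)%N.
Proof.
move=> /row_weight_neq0 /(_ (size mu)) [_].
by rewrite [entry mu _]nth_default // leqn0 intpart_size_le.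
Qed.

Definition ct (la : intpart) : K := ctilde_conj q s la.

Lemma ctE (la : intpart) n : (size la <= n)%N ->
  ct la = (\prod_(c < n) bw (entry la c) (entry la c.+1))^-1.
Proof.
move=> sla.
rewrite -(@prod_stable (fun c => bw (entry la c) (entry la c.+1)) (size la)) //; last first.
  by move=> c sc; rewrite !nth_default ?leqW // bw00.
rewrite -prodfV; apply: eq_bigr => c _.
by rewrite /bw intpart_nth_anti // invf_div.
Qed.

Lemma prod_bw_neq0 (la : intpart) n :
  \prod_(c < n) bw (entry la c) (entry la c.+1) != 0.
Proof.
apply/prodf_neq0 => c _; rewrite /bw intpart_nth_anti //.
by rewrite mulf_neq0 ?invr_eq0 ?qpoch_qq_neq0 ?qpoch_ss_neq0.
Qed.

Lemma ct_neq0 la : ct la != 0.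
Proof. by rewrite (ctE (leqnn _)) invr_eq0 prod_bw_neq0. Qed.

Lemma up_weight_rows x y n (mu nu la : intpart) :
  (size mu <= n.+1)%N -> (size nu <= n.+1)%N -> (size la <= n.+1)%N ->
  up_weight q s x y n mu nu la = row_weight x mu la * row_weight y nu la * ct la.
Proof.
move=> smu snu sla; rewrite (row_weightE _ smu sla) (row_weightE _ snu sla) (ctE sla).
apply: (mulIf (prod_bw_neq0 la n.+1)); rewrite mulfVK ?prod_bw_neq0 //.
rewrite /up_weight mulrACA -!mulrA -!big_split /=; congr (_ * (_ * _)).
by apply: eq_bigr => c _; rewrite /row_factor; ring.
Qed.

Lemma down_weight_rows x y n (mu nu ka : intpart) :
  (size mu <= n)%N -> (size nu <= n)%N -> (size ka <= n)%N ->
  down_weight q s x y n mu nu ka =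
  row_weight x ka nu * row_weight y ka mu * (ct mu * ct nu / ct ka).
Proof.
move=> smu snu ska; rewrite (row_weightE _ ska snu) (row_weightE _ ska smu).
rewrite (ctE smu) (ctE snu) (ctE ska) invrK.
have hmu := prod_bw_neq0 mu n; have hnu := prod_bw_neq0 nu n.
(* The leading [fw] factor joins those of the later columns, the last one being [fw z 0 0 = 1]. This
   shifts the grouping by one column to that of [down_weight]. *)
have shift z (la : intpart) : (size la <= n)%N ->
   fw z (entry la 0) (entry ka 0) *
   \prod_(c < n) row_factor z ka la c =
   \prod_(c < n) (fw z (entry la c) (entry ka c) * gw z (entry ka c) (entry la c.+1))
     * \prod_(c < n) bw (entry la c) (entry la c.+1).
  move=> sla.
  have E : fw z (entry la 0) (entry ka 0) * \prod_(c < n) fw z (entry la c.+1) (entry ka c.+1)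
    = \prod_(c < n) fw z (entry la c) (entry ka c).
    transitivity (\prod_(c < n.+1) fw z (entry la c) (entry ka c)).
      by rewrite big_ord_recl.
    by rewrite big_ord_recr /= ![entry _ n]nth_default // fw00 mulr1.
  by rewrite !big_split /= -E; ring.
rewrite !shift // /down_weight !big_split /=; field.
by rewrite hmu hnu.
Qed.

Lemma up_weight_ext x y n (mu mu' nu nu' la la' : seq nat) :
  entry mu =1 entry mu' -> entry nu =1 entry nu' -> entry la =1 entry la' ->
  up_weight q s x y n mu nu la = up_weight q s x y n mu' nu' la'.
Proof.
move=> Em En El; rewrite /up_weight !Em !En !El; congr (_ * _).
by apply: eq_bigr => c _; rewrite !Em !En !El.
Qed.

Lemma down_weight_ext x y n (mu mu' nu nu' la la' : seq nat) :
  entry mu =1 entry mu' -> entry nu =1 entry nu' -> entry la =1 entry la' ->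
  down_weight q s x y n mu nu la = down_weight q s x y n mu' nu' la'.
Proof.
move=> Em En El; rewrite /down_weight.
by apply: eq_bigr => c _; rewrite !Em !En !El.
Qed.

Lemma up_weight_unsorted x y n (mu nu t : seq nat) : size t = n.+1 ->
  ~~ sorted geq t -> up_weight q s x y n mu nu t = 0.
Proof.
move=> st; apply: contraNeq => /[!mulf_eq0] /[!negb_or] /andP[_ /prodf_neq0 h].
apply/(sortedP 0%N) => i; rewrite st => lt_i.
have := h (Ordinal (ltnW lt_i)) isT; rewrite !mulf_eq0 !negb_or.
by move=> /andP[/andP[_ /bw_neq0]].
Qed.

Lemma down_weight_unsorted x y n (mu nu t : seq nat) : size t = n ->
  ~~ sorted geq t -> down_weight q s x y n mu nu t = 0.
Proof.
move=> st; apply: contraNeq => /prodf_neq0 h.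
apply/(sortedP 0%N) => i; rewrite st => lt_i.
have := h (Ordinal (ltnW lt_i)) isT; rewrite !mulf_eq0 !negb_or.
by move=> /andP[_ /andP[_ /bw_neq0]].
Qed.

Lemma nth_pad (la : seq nat) n : (size la <= n)%N -> entry (mkseq (entry la) n) =1 entry la.
Proof.
move=> sla i; have [lt_i|le_i] := ltnP i n; first by rewrite nth_mkseq.
by rewrite !nth_default ?size_mkseq // (leq_trans sla).
Qed.

Lemma size_part_of_seq t : sorted geq t -> (size (part_of_seq t) <= size t)%N.
Proof. by move=> st; rewrite part_of_seqE // size_filter count_size. Qed.

(** The same n serves as number of columns, as bound on the entries and as extra part k, so that a
    single limit remains to be taken. *)
Lemma row_cauchy_truncated x y n (mu nu : intpart) :
  (size mu <= n)%N -> (size nu <= n)%N ->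
  \sum_(la <- box n.+1 n) phw (x * y) n (entry la 0) *
     (row_weight x mu la * row_weight y nu la * ct la) =
  gw x n (entry nu 0) * gw y n (entry mu 0) *
  \sum_(ka <- box n n) bw n (entry ka 0) *
     (row_weight x ka nu * row_weight y ka mu * (ct mu * ct nu / ct ka)).
Proof.
move=> smu snu.
have := zip_columns q_ok s_ok x y (leqnn n) (size_mkseq (entry mu) n) (size_mkseq (entry nu) n).
rewrite !nth_pad //.
rewrite (@big_box _ n.+1 n _ (fun la => phw (x * y) n (entry la 0) *
     (row_weight x mu la * row_weight y nu la * ct la))); last first.
- move=> t st sot; rewrite nth_part_of_seq //.
  rewrite -(@up_weight_rows _ _ n) ?(leqW smu) ?(leqW snu) //; last first.
    by rewrite -st size_part_of_seq.
  congr (_ * _); apply: up_weight_ext; [exact: nth_pad|exact: nth_pad|].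
  by move=> i; rewrite nth_part_of_seq.
- by move=> t st sot; rewrite up_weight_unsorted // mulr0.
move=> ->; congr (_ * _).
apply: big_box => t st sot; first by rewrite down_weight_unsorted // mulr0.
rewrite nth_part_of_seq // -(@down_weight_rows _ _ n) //; last first.
  by rewrite -st size_part_of_seq.
congr (_ * _); apply: down_weight_ext; [exact: nth_pad|exact: nth_pad|].
by move=> i; rewrite nth_part_of_seq.
Qed.

End RowKernel.

(** * Bounds and limits *)

Section ComplexAnalysis.
Variable R : realType.

Lemma cvgn_geometric_increments (v : nat -> R) (C r : R) : 0 <= r < 1 ->
  (forall n, `|v n.+1 - v n| <= C * r ^+ n) -> cvgn v.
Proof.
move=> /andP[r0 r1] vC.
have -> : v = (fun n => v 0%N + series (telescope v) n).
  by apply/funext => n; exact: eq_sum_telescope.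
apply: is_cvgD; first exact: is_cvg_cst.
apply: normed_cvg.
apply: (@series_le_cvg _ _ (geometric C r)) => //.
- by move=> n; rewrite /=.
- by move=> n; apply: le_trans (vC n).
- by apply: is_cvg_geometric_series; rewrite ger0_norm.
Qed.

(* The topology of [R[i]] is inferred from its [numFieldType] structure only. *)
Definition complex_numField : numFieldType := R[i].
Local Notation K := complex_numField.

Lemma Re_norm (z : R[i]) : `|z| = (complex.Re `|z|)%:C%C.
Proof. by rewrite RRe_real // ger0_real. Qed.

Lemma Re_norm_ge0 (z : R[i]) : 0 <= complex.Re `|z|.
Proof. by have := normr_ge0 z; rewrite Re_norm ler0c. Qed.

Lemma normc_ge_Im (z : R[i]) : `|complex.Im z|%:C%C <= `|z|.
Proof.
have := normc_ge_Re (z * 'i%C); rewrite ReiNIm normrN => /le_trans; apply.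
by rewrite normrM [X in _ * X]normc_def /= expr0n expr1n add0r sqrtr1 mulr1.
Qed.

Lemma cvgn_complex (u : nat -> K) (l : K) :
  (fun n => complex.Re (u n)) @ \oo --> complex.Re l ->
  (fun n => complex.Im (u n)) @ \oo --> complex.Im l ->
  u @ \oo --> l.
Proof.
move=> /cvgrPdist_le ul /cvgrPdist_le vl; apply/cvgrPdist_le => e e0.
have eE : e = (complex.Re e)%:C%C by rewrite RRe_real // gtr0_real.
have e0' : 0 < complex.Re e by move: e0; rewrite eE ltcR.
have e2 : 0 < complex.Re e / 2 by rewrite divr_gt0.
near=> n.
have -> : l - u n = (complex.Re (l - u n))%:C%C + 'i%C * (complex.Im (l - u n))%:C%C.
  exact: complexE.
rewrite (le_trans (ler_normD _ _)) // normrM.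
have -> : `|'i%C : R[i]| = 1 by rewrite normc_def /= expr0n expr1n add0r sqrtr1.
rewrite mul1r eE (splitr (complex.Re e)) rmorphD lerD //.
  rewrite normc_def /= expr0n addr0 sqrtr_sqr lecR; near: n.
  by apply: filterS (ul _ e2) => n; case: (l) (u n) => [? ?] [? ?].
rewrite normc_def /= expr0n addr0 sqrtr_sqr lecR; near: n.
by apply: filterS (vl _ e2) => n; case: (l) (u n) => [? ?] [? ?].
Unshelve. all: by end_near.
Qed.

(** Completeness is borrowed from [R], through real and imaginary parts. *)
Lemma cvgn_complex_geometric (u : nat -> K) (C q : K) : `|q| < 1 ->
  (forall n, `|u n.+1 - u n| <= C * `|q| ^+ n) -> exists l : K, u @ \oo --> l.
Proof.
move=> q1 uC.
have C0 : 0 <= C by have := le_trans (normr_ge0 _) (uC 0%N); rewrite expr0 mulr1.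
have CE : C = (complex.Re C)%:C%C by rewrite RRe_real // ger0_real.
have hr : 0 <= complex.Re `|q| < 1.
  by rewrite Re_norm_ge0 /=; move: q1; rewrite Re_norm ltcR.
have cre : cvgn (fun n => complex.Re (u n)).
  apply: (cvgn_geometric_increments (C := complex.Re C) hr) => n.
  have := le_trans (normc_ge_Re _) (uC n).
  rewrite [X in _ <= X](_ : _ = (complex.Re C * complex.Re `|q| ^+ n)%:C%C) ?lecR.
    by case: (u n) (u n.+1) => [? ?] [? ?].
  by rewrite rmorphM rmorphXn /= -Re_norm -CE.
have cim : cvgn (fun n => complex.Im (u n)).
  apply: (cvgn_geometric_increments (C := complex.Re C) hr) => n.
  have := le_trans (normc_ge_Im _) (uC n).
  rewrite [X in _ <= X](_ : _ = (complex.Re C * complex.Re `|q| ^+ n)%:C%C) ?lecR.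
    by case: (u n) (u n.+1) => [? ?] [? ?].
  by rewrite rmorphM rmorphXn /= -Re_norm -CE.
exists (limn (fun n => complex.Re (u n)) +i* limn (fun n => complex.Im (u n)))%C.
exact: cvgn_complex.
Qed.

(** By 1 + t <= exp t and the geometric series, exp(c/(1 - |q|)) is a bound. *)
Lemma prod_1D_geometric_bounded (q c : R[i]) : `|q| < 1 -> 0 <= c ->
  exists M, forall n, \prod_(i < n) (1 + c * `|q| ^+ i) <= M.
Proof.
move=> q1 c0.
have cE : c = (complex.Re c)%:C%C by rewrite RRe_real // ger0_real.
have c0' : 0 <= complex.Re c by move: c0; rewrite cE ler0c.
have r1 : complex.Re `|q| < 1 by move: q1; rewrite Re_norm ltcR.
move: (Re_norm_ge0 q) r1 c0'; rewrite cE Re_norm.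
move: (complex.Re `|q|) (complex.Re c) => r d r0 r1 d0 {q1 c0 cE}.
exists (expR (d / (1 - r)))%:C%C => n.
have -> : \prod_(i < n) (1 + d%:C%C * r%:C%C ^+ i) = (\prod_(i < n) (1 + d * r ^+ i))%:C%C :> R[i].
  rewrite rmorph_prod; apply: eq_bigr => i _.
  by rewrite rmorphD rmorphM rmorphXn rmorph1.
rewrite lecR; apply: (@le_trans _ _ (\prod_(i < n) expR (d * r ^+ i))).
  apply: ler_prod => i _; rewrite expR_ge1Dx andbT.
  by rewrite addr_ge0 // mulr_ge0 // exprn_ge0.
rewrite -expR_sum ler_expR -mulr_sumr ler_wpM2l //.
rewrite -[leRHS]mul1r ler_pdivlMr ?subr_gt0 // mulrC -[1 - r]opprB mulNr -subrX1 opprB.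
by rewrite gerBl exprn_ge0.
Qed.

End ComplexAnalysis.

(** * Uniform bounds on the one-row weights *)

Section Bounds.
Variables (K : numFieldType) (q s : K).
Hypotheses (q1 : `|q| < 1) (s1 : `|s| < 1).
Hypothesis prod_bounded : forall c : K, 0 <= c ->
  exists M, forall n, \prod_(i < n) (1 + c * `|q| ^+ i) <= M.

Lemma norm_factor_le (a : K) i : `|a * q ^+ i| <= `|a|.
Proof. by rewrite normrM normrX ler_piMr // exprn_ile1 // ltW. Qed.

Lemma qpoch_factor_neq0 (a : K) i : `|a| < 1 -> 1 - a * q ^+ i != 0.
Proof.
move=> a1; rewrite subr_eq0; apply/eqP => aq.
by have := le_lt_trans (norm_factor_le a i) a1; rewrite -aq normr1 ltxx.
Qed.

Lemma qpoch_bounded (a : K) : exists M, forall n, `|qpoch q a n| <= M.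
Proof.
have [M hM] := prod_bounded (normr_ge0 a); exists M => n.
apply: le_trans (hM n); rewrite normr_prod; apply: ler_prod => i _.
by rewrite normr_ge0 (le_trans (ler_normB _ _)) // normr1 normrM normrX.
Qed.

Lemma qpoch_inv_bounded (a : K) : `|a| < 1 ->
  exists M, forall n, `|(qpoch q a n)^-1| <= M.
Proof.
move=> a1; have a1' : 0 < 1 - `|a| by rewrite subr_gt0.
(* For t = |a||q|^i <= |a| one has 1/(1 - t) = 1 + t/(1 - t) <= 1 + t/(1 - |a|), again of the form 1
   + c|q|^i. *)
have c0 : 0 <= `|a| / (1 - `|a|) by rewrite divr_ge0 // ltW.
have [M hM] := prod_bounded c0; exists M => n.
apply: le_trans (hM n); rewrite normfV normr_prod -prodfV; apply: ler_prod => i _.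
rewrite invr_ge0 normr_ge0 /=.
have t0 : 0 < `|1 - a * q ^+ i| by rewrite normr_gt0 qpoch_factor_neq0.
rewrite -[leLHS]mul1r ler_pdivrMr //.
set t := `|a| * `|q| ^+ i.
have tE : `|a| / (1 - `|a|) * `|q| ^+ i = t / (1 - `|a|) by rewrite /t mulrAC.
have tq : t = `|a * q ^+ i| by rewrite normrM normrX.
have ta : t <= `|a| by rewrite tq norm_factor_le.
have t0' : 0 <= t by rewrite tq.
have h : 1 - t <= `|1 - a * q ^+ i|.
  by rewrite tq -[X in X - _]normr1; apply: lerB_dist.
rewrite tE; apply: (@le_trans _ _ ((1 + t / (1 - `|a|)) * (1 - t))); last first.
  by rewrite ler_wpM2l // addr_ge0 // divr_ge0 // ltW.
have -> : (1 + t / (1 - `|a|)) * (1 - t) = 1 + t * ((1 - t) / (1 - `|a|) - 1) by ring.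
rewrite lerDl mulr_ge0 // subr_ge0 ler_pdivlMr // mul1r.
by rewrite lerD2l lerN2.
Qed.

Lemma xpoch_sum_bounded (x : K) : `|x| < 1 ->
  exists M, forall k, \sum_(l < k) `|xpoch q s x l| <= M.
Proof.
(* |x + s q^i| <= r(1 + (|s|/r)|q|^i) gives geometric decay of ratio r. Since x may be 0, |x| cannot
   be the denominator; the midpoint with 1 is positive and still below 1. *)
move=> x1; pose r := (1 + `|x|) / 2.
have r0 : 0 < r by rewrite divr_gt0 // ltr_pwDl.
have r1 : r < 1.
  by rewrite /r ltr_pdivrMr // mul1r [ltRHS](_ : _ = 1 + 1) ?ltrD2l //; ring.
have xr : `|x| <= r.
  rewrite /r ler_pdivlMr // (_ : `|x| * 2 = `|x| + `|x|) ?lerD2r ?ltW //; ring.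
have r1' : 0 < 1 - r by rewrite subr_gt0.
have c0 : 0 <= `|s| / r by rewrite divr_ge0 // ltW.
have [M hM] := prod_bounded c0.
have M0 : 0 <= M by have := hM 0%N; rewrite big_ord0; exact: le_trans.
have xb l : `|xpoch q s x l| <= M * r ^+ l.
  apply: (@le_trans _ _ (\prod_(i < l) (1 + `|s| / r * `|q| ^+ i) * r ^+ l)); last first.
    by rewrite ler_wpM2r ?exprn_ge0 // ltW.
  rewrite -[l in r ^+ l]card_ord -prodr_const -big_split /= normr_prod.
  apply: ler_prod => i _; rewrite normr_ge0 (le_trans (ler_normD _ _)) //.
  rewrite mulrDl mul1r lerD // normrM normrX.
  by rewrite mulrAC divfK // lt0r_neq0.
exists (M / (1 - r)) => k.
apply: (@le_trans _ _ (\sum_(l < k) M * r ^+ l)); first by apply: ler_sum => l _.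
rewrite -mulr_sumr ler_wpM2l // -[leRHS]mul1r ler_pdivlMr //.
rewrite mulrC -[1 - r]opprB mulNr -subrX1 opprB.
by rewrite gerBl exprn_ge0 // ltW.
Qed.

Let s1' : `|s ^+ 2| < 1.
Proof. by rewrite normrX exprn_ilt1. Qed.

Lemma gw_bounded (x : K) : exists M, forall a b, `|gw q s x a b| <= M.
Proof.
have [M hM] := qpoch_bounded (- (s * x)); have [N hN] := qpoch_inv_bounded q1.
exists (M * N) => a b; rewrite /gw; case: ifP => _.
  by rewrite normrM ler_pM.
by rewrite normr0 mulr_ge0 // (le_trans _ (hM 0%N), le_trans _ (hN 0%N)).
Qed.

Lemma phw_bounded (z : K) : exists M, forall a b, `|phw q z a b| <= M.
Proof.
have [M hM] := qpoch_bounded z; have [N hN] := qpoch_inv_bounded q1.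
exists (M * N) => a b; rewrite /phw; case: ifP => _.
  by rewrite normrM ler_pM.
by rewrite normr0 mulr_ge0 // (le_trans _ (hM 0%N), le_trans _ (hN 0%N)).
Qed.

Lemma bw_bounded : exists M, forall a b, `|bw q s a b| <= M.
Proof.
have [M hM] := qpoch_bounded q; have [N hN] := qpoch_inv_bounded s1'.
exists (M * N) => a b; rewrite /bw; case: ifP => _.
  by rewrite normrM ler_pM.
by rewrite normr0 mulr_ge0 // (le_trans _ (hM 0%N), le_trans _ (hN 0%N)).
Qed.

Lemma fw_sum_bounded (x : K) : `|x| < 1 ->
  exists M, forall k m, \sum_(l < k) `|fw q s x l m| <= M.
Proof.
move=> /xpoch_sum_bounded[D hD]; have [N hN] := qpoch_inv_bounded q1.
have N0 : 0 <= N by exact: le_trans (hN 0%N).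
have D0 : 0 <= D by have := hD 0%N; rewrite big_ord0.
exists (D * N) => k m.
have [km|mk] := leqP k m.
  rewrite big1 ?mulr_ge0 // => i _.
  by rewrite /fw leqNgt (leq_trans (ltn_ord i) km) normr0.
rewrite -(subnKC (ltnW mk)) big_split_ord /= big1 ?add0r => [|i _]; last first.
  by rewrite /fw leqNgt ltn_ord normr0.
apply: (@le_trans _ _ (\sum_(i < k - m) `|xpoch q s x i| * N)).
  apply: ler_sum => i _; rewrite /fw leq_addr addKn normrM ler_wpM2l //.
by rewrite -mulr_suml ler_wpM2r.
Qed.

Definition seq_row_weight (x : K) n (mu t : seq nat) : K :=
  fw q s x (entry t 0) (entry mu 0) * \prod_(c < n.+1) row_factor q s x mu t c.

(** Each entry of [t] is the upper argument of exactly one [fw], summable in it uniformly in [mu],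
    while [gw] and [bw] are merely bounded. Every entry thus costs a constant factor. *)
Lemma seq_row_sum_bounded (x : K) n : `|x| < 1 ->
  exists M, forall k mu, \sum_(t <- seqs_le n.+1 k) `|seq_row_weight x n mu t| <= M.
Proof.
move=> x1; have [D hD] := fw_sum_bounded x1.
have [G hG] := gw_bounded x; have [B hB] := bw_bounded.
have D0 : 0 <= D by have := hD 0%N 0%N; rewrite big_ord0.
have G0 : 0 <= G by exact: le_trans (hG 0%N 0%N).
have B0 : 0 <= B by exact: le_trans (hB 0%N 0%N).
have f0D m : `|fw q s x 0 m| <= D by have := hD 1%N m; rewrite big_ord1.
elim: n => [|n [M hM]].
  exists (D * (G * B * D)) => k mu; rewrite big_seqs_leS.
  apply: (@le_trans _ _ (\sum_(l < k.+1) `|fw q s x l (entry mu 0)| * (G * B * D))).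
    apply: ler_sum => l _; rewrite big_seq1 /seq_row_weight big_ord1 normrM ler_wpM2l //.
    rewrite /row_factor [entry [:: _] 1]/= 2!normrM ler_pM ?mulr_ge0 ?f0D //.
    by rewrite ler_pM.
  by rewrite -mulr_suml ler_wpM2r // !mulr_ge0.
exists (D * (G * B * M)) => k mu; rewrite big_seqs_leS.
have M0 : 0 <= M by apply: le_trans (hM 0%N [::]); exact: sumr_ge0.
apply: (@le_trans _ _ (\sum_(l < k.+1) `|fw q s x l (entry mu 0)| * (G * B * M))); last first.
  by rewrite -mulr_suml ler_wpM2r // !mulr_ge0.
apply: ler_sum => l _.
apply: (@le_trans _ _ (`|fw q s x l (entry mu 0)| *
   (G * B * \sum_(t <- seqs_le n.+1 k) `|seq_row_weight x n (behead mu) t|))); last first.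
  by rewrite !ler_wpM2l // mulr_ge0.
rewrite !mulr_sumr; apply: ler_sum => t _.
have -> : seq_row_weight x n.+1 mu ((l : nat) :: t) =
  fw q s x l (entry mu 0) * (gw q s x (entry mu 0) (entry t 0) * bw q s l (entry t 0) *
    seq_row_weight x n (behead mu) t).
  rewrite /seq_row_weight big_ord_recl /= {1}/row_factor /= !nth_behead !mulrA.
  congr (_ * _); apply: eq_bigr => c _.
  by rewrite /row_factor !nth_behead.
by rewrite !normrM !(ler_wpM2l, ler_wpM2r, ler_pM) ?mulr_ge0.
Qed.

Let q_ok i : 1 - q * q ^+ i != 0. Proof. exact: qpoch_factor_neq0. Qed.
Let s_ok i : 1 - s ^+ 2 * q ^+ i != 0. Proof. exact: qpoch_factor_neq0. Qed.

Lemma row_weight_l1_bounded (x : K) N : `|x| < 1 ->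
  exists M, forall mu : intpart, (size mu <= N)%N -> forall A : {fset intpart},
    \sum_(la <- A) `|row_weight q s x mu la| <= M.
Proof.
move=> x1; have [M hM] := seq_row_sum_bounded N x1; exists M => mu smu A.
(* With this k, interlacing puts every nonzero term of the finite set [A] into a box with [N.+1]
   rows. *)
pose k := \max_(la <- A) entry (la : intpart) 0.
apply: (@le_trans _ _ (\sum_(la <- A `&` box N.+1 k) `|row_weight q s x mu la|)).
  rewrite le_eqVlt (big_fset_supp (@fsubsetIl _ A (box N.+1 k))) ?eqxx // => la lA.
  rewrite in_fsetI lA /= mem_box negb_and => h; apply/eqP; rewrite normr_eq0.
  apply: contraTT h => /row_weight_size sla; rewrite negb_or !negbK.
  rewrite (leq_trans sla) //=.
  exact: (@leq_bigmax_seq _ _ _ (fun la : intpart => entry la 0)).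
apply: le_trans (hM k mu).
apply: le_trans (ler_sum_fset (@fsubsetIr _ A (box N.+1 k)) (fun la => normr_ge0 _)) _.
rewrite -(@big_box _ _ _ (fun t => if sorted geq t then
    `|row_weight q s x mu (part_of_seq t)| else 0)) => [|t _ /negbTE->//|t _ ->//].
rewrite big_seq [leRHS]big_seq; apply: ler_sum => t; rewrite mem_seqs_le => /andP[/eqP st _].
case: ifP => // sot.
rewrite (@row_weightE _ _ _ _ _ _ N.+1) ?(leqW smu) //; last first.
  by rewrite -st size_part_of_seq.
rewrite /seq_row_weight /row_factor nth_part_of_seq //.
rewrite le_eqVlt; apply/orP; left; apply/eqP; congr (`|_ * _|).
by apply: eq_bigr => c _; rewrite !nth_part_of_seq.
Qed.

Lemma ct_bounded N : exists M, forall la : intpart, (size la <= N)%N ->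
  `|ct q s la| <= M /\ `|(ct q s la)^-1| <= M.
Proof.
have [B hB] := bw_bounded; have [M hM] := qpoch_bounded (s ^+ 2).
have [L hL] := qpoch_inv_bounded q1.
have B0 : 0 <= B by exact: le_trans (hB 0%N 0%N).
have M0 : 0 <= M by exact: le_trans (hM 0%N).
have L0 : 0 <= L by exact: le_trans (hL 0%N).
exists (B ^+ N + (M * L) ^+ N) => la sla; rewrite (ctE q s sla) invrK; split.
  rewrite -prodfV normr_prod -[leLHS]add0r lerD ?exprn_ge0 //.
  rewrite -[N in _ ^+ N]card_ord -prodr_const; apply: ler_prod => c _.
  rewrite normr_ge0 /bw intpart_nth_anti // invf_div normrM ler_pM //.
rewrite normr_prod -[leLHS]addr0 lerD ?exprn_ge0 ?mulr_ge0 //.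
rewrite -[N in _ ^+ N]card_ord -prodr_const; apply: ler_prod => c _.
by rewrite normr_ge0 hB.
Qed.

End Bounds.

(** * Kernels on partitions *)

Lemma subpart_trans mu la nu : subpart mu la -> subpart la nu -> subpart mu nu.
Proof. by move=> h1 h2 c; exact: leq_trans (h1 c) (h2 c). Qed.

Definition below (la : intpart) : {fset intpart} :=
  [fset ka in box (size la) (entry la 0) | `[< subpart ka la >]].

Lemma mem_below ka la : reflect (subpart ka la) (ka \in below la).
Proof.
rewrite !inE /= mem_box; apply: (iffP andP) => [[_ /asboolP]//|h].
by split; [rewrite subpart_size //= h | apply/asboolP].
Qed.

Lemma sub_below ka la : subpart ka la -> below ka `<=` below la.
Proof.
move=> h; apply/fsubsetP => t /mem_below ht; apply/mem_below.
exact: subpart_trans h.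
Qed.

Section Kernels.
Variable R : realType.
Local Notation K := R[i].
Implicit Types U D : intpart -> intpart -> K.

Definition supported U := forall mu la, U mu la != 0 -> subpart mu la.

(** The l1 bound is uniform only on partitions of bounded length; the bound on the growth of the
    length is what lets two such estimates be composed. *)
Definition tame U :=
  [/\ supported U,
      exists m, forall mu la : intpart, U mu la != 0 -> (size la <= size mu + m)%N
    & forall N, exists M, forall mu : intpart, (size mu <= N)%N ->
        forall A : {fset intpart}, \sum_(la <- A) `|U mu la| <= M].

Definition idker (mu la : intpart) : K := (mu == la)%:R.

Definition kernel_comp U1 U2 mu la : K := \sum_(rho <- below la) U1 mu rho * U2 rho la.

(* [U mu la] stands for [F_{la/mu}] and [D nu la] for [F*_{la/nu}]. *)
Definition comm U D (z : K) := forall mu nu,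
  sums_to (fun la => U mu la * D nu la)
    (z * \sum_(ka <- below nu) U ka nu * D ka mu).

Lemma supported_comp U1 U2 : supported U1 -> supported U2 -> supported (kernel_comp U1 U2).
Proof.
move=> s1 s2 mu la; rewrite /kernel_comp big_seq; apply: contra_neqP => h.
apply: big1 => rho /mem_below hr; apply/eqP; apply: contra_notT h.
rewrite mulf_eq0 negb_or => /andP[/s1 h1 _]; exact: subpart_trans hr.
Qed.

Lemma tame_comp U1 U2 : tame U1 -> tame U2 -> tame (kernel_comp U1 U2).
Proof.
move=> [s1 [m1 h1] b1] [s2 [m2 h2] b2]; split; first exact: supported_comp.
  exists (m1 + m2)%N => mu la; apply: contra_neqT => h.
  rewrite /kernel_comp big1 // => rho _; apply/eqP; apply: contraNT h.
  rewrite mulf_eq0 negb_or => /andP[/h1 hr /h2 hl].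
  by rewrite (leq_trans hl) // addnA leq_add2r.
move=> N; have [M1 hM1] := b1 N; have [M2 hM2] := b2 (N + m1)%N.
exists (M1 * M2) => mu smu A.
have M20 : 0 <= M2.
  by have := hM2 empty_intpart (leq0n _) fset0; rewrite big_seq_fset0.
pose B := \bigcup_(la <- A) below la.
apply: (@le_trans _ _ (\sum_(la <- A) \sum_(rho <- B) `|U1 mu rho| * `|U2 rho la|)).
  rewrite big_seq [leRHS]big_seq; apply: ler_sum => la lA.
  rewrite (le_trans (ler_norm_sum _ _ _)) //.
  under eq_bigr do rewrite normrM.
  apply: ler_sum_fset; last by move=> rho; rewrite mulr_ge0.
  exact: bigfcup_sup.
rewrite exchange_big /=; apply: (@le_trans _ _ (\sum_(rho <- B) `|U1 mu rho| * M2)).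
  apply: ler_sum => rho _; rewrite -mulr_sumr.
  have [->|/h1 hr] := eqVneq (U1 mu rho) 0; first by rewrite normr0 !mul0r.
  by rewrite ler_wpM2l // hM2 // (leq_trans hr) // leq_add2r.
by rewrite -mulr_suml ler_wpM2r // hM1.
Qed.

Lemma tame_idker : tame idker.
Proof.
have h mu la : idker mu la != 0 -> mu = la.
  by rewrite /idker; case: (eqVneq mu la) => // _; rewrite mulr0n eqxx.
split; first by move=> mu la /h ->.
  by exists 0%N => mu la /h ->; rewrite addn0.
move=> N; exists 1 => mu _ A.
apply: (@le_trans _ _ (\sum_(la <- mu |` A) `|idker mu la|)).
  by apply: ler_sum_fset => //; exact: fsubsetUr.
rewrite (@big_fset_supp _ _ [fset mu]) ?fsubsetUl //; last first.
  move=> la _; rewrite in_fset1 /idker eq_sym => /negbTE ->; exact: normr0.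
by rewrite big_seq_fset1 /idker eqxx normr1.
Qed.

Lemma big_below_sub U D ka la mu : supported U -> subpart ka la ->
  \sum_(t <- below la) U t ka * D t mu = \sum_(t <- below ka) U t ka * D t mu.
Proof.
move=> sU h; apply: big_fset_supp => [|t _]; first exact: sub_below.
move=> /mem_below ht; have [->|/sU//] := eqVneq (U t ka) 0; exact: mul0r.
Qed.

(** By the support conditions both finite sums run over partitions contained in [mu] and in [nu].
    With this, [comm_comp], which composes in the first argument, serves for the second as well. *)
Lemma comm_sym U D z : supported U -> supported D -> comm U D z -> comm D U z.
Proof.
move=> sU sD h mu nu.
apply: (@sums_to_ext _ _ (fun la => U nu la * D mu la)) => [la|]; first exact: mulrC.
suff -> : \sum_(ka <- below nu) D ka nu * U ka mu =
   \sum_(ka <- below mu) U ka mu * D ka nu by exact: h.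
pose B := below nu `|` below mu.
rewrite -(@big_fset_supp _ _ (below nu) B) ?fsubsetUl //; last first.
  move=> t _ /mem_below ht; have [->|/sD//] := eqVneq (D t nu) 0; exact: mul0r.
rewrite -(@big_fset_supp _ _ (below mu) B) ?fsubsetUr //; last first.
  move=> t _ /mem_below ht; have [->|/sU//] := eqVneq (U t mu) 0; exact: mul0r.
by apply: eq_bigr => t _; rewrite mulrC.
Qed.

(** [D] is moved past [U2] with the intermediate [rho] fixed, then past [U1] with [ka] fixed. Only
    the exchange of [rho] with [la] is infinite; it rests on the absolute bound [ha]. *)
Lemma comm_comp U1 U2 D z1 z2 : tame U1 -> tame U2 -> tame D ->
  comm U1 D z1 -> comm U2 D z2 -> comm (kernel_comp U1 U2) D (z1 * z2).
Proof.
move=> [s1 [m1 h1] b1] [s2 [m2 h2] b2] [sD _ bD] c1 c2 mu nu.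
have [M1 hM1] := b1 (size mu); have [M2 hM2] := b2 (size mu + m1)%N.
have [MD hMD] := bD (size nu).
have M20 : 0 <= M2.
  by have := hM2 empty_intpart (leq0n _) fset0; rewrite big_seq_fset0.
have MD0 : 0 <= MD.
  by have := hMD empty_intpart (leq0n _) fset0; rewrite big_seq_fset0.
have bDla la : `|D nu la| <= MD.
  by have := hMD nu (leqnn _) [fset la]; rewrite big_seq_fset1.
pose a (rho la : intpart) : K := U1 mu rho * (U2 rho la * D nu la).
pose r (rho : intpart) : K :=
  U1 mu rho * (z2 * \sum_(ka <- below nu) U2 ka nu * D ka rho).
have ha (A B : {fset intpart}) :
    \sum_(i <- A) \sum_(j <- B) `|a i j| <= M1 * (M2 * MD).
  apply: (@le_trans _ _ (\sum_(i <- A) `|U1 mu i| * (M2 * MD))); last first.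
    by rewrite -mulr_suml ler_wpM2r ?mulr_ge0 // hM1.
  apply: ler_sum => rho _; rewrite /a; under eq_bigr do rewrite !normrM.
  rewrite -mulr_sumr.
  have [->|/h1 hr] := eqVneq (U1 mu rho) 0; first by rewrite normr0 !mul0r.
  rewrite ler_wpM2l //.
  apply: (@le_trans _ _ (\sum_(j <- B) `|U2 rho j| * MD)).
    by apply: ler_sum => la _; rewrite ler_wpM2l.
  by rewrite -mulr_suml ler_wpM2r // hM2.
have hr rho : sums_to (a rho) (r rho) by apply: sums_toZ; exact: c2.
have hc la : sums_to (a^~ la) (kernel_comp U1 U2 mu la * D nu la).
  rewrite /kernel_comp mulr_suml.
  rewrite (eq_bigr (fun rho => a rho la)); last by move=> rho _; rewrite /a mulrA.
  apply: sums_to_fin => rho /mem_below hrho; rewrite /a.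
  have [->|/s2//] := eqVneq (U2 rho la) 0; first by rewrite mul0r mulr0.
apply: (sums_to_exchange ha hr _ hc).
(* The range of [t] may shrink from [below nu] to [below ka] because [U1 t ka] vanishes outside the
   latter. *)
have E : z1 * z2 * \sum_(ka <- below nu) kernel_comp U1 U2 ka nu * D ka mu =
    \sum_(ka <- below nu) z2 * U2 ka nu *
       (z1 * \sum_(t <- below ka) U1 t ka * D t mu).
  transitivity (\sum_(ka <- below nu) z2 * U2 ka nu *
       (z1 * \sum_(t <- below nu) U1 t ka * D t mu)).
    transitivity (z1 * z2 * \sum_(ka <- below nu) U2 ka nu *
       \sum_(t <- below nu) U1 t ka * D t mu); last first.
      by rewrite mulr_sumr; apply: eq_bigr => ka _; ring.
    congr (_ * _); under [RHS]eq_bigr do rewrite mulr_sumr.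
    rewrite [RHS]exchange_big; apply: eq_bigr => t _ /=.
    by rewrite /kernel_comp mulr_suml; apply: eq_bigr => ka _; ring.
  rewrite !big_seq; apply: eq_bigr => ka /mem_below hk.
  by rewrite big_below_sub.
rewrite E; apply: (@sums_to_ext _ _ (fun rho => \sum_(ka <- below nu)
    z2 * U2 ka nu * (U1 mu rho * D ka rho))).
  by move=> rho; rewrite /r !mulr_sumr; apply: eq_bigr => ka _; ring.
apply: (@sums_to_sum _ _ _ _ (fun ka rho => z2 * U2 ka nu * (U1 mu rho * D ka rho))) => ka.
exact/sums_toZ/c1.
Qed.

Lemma comm_idker D : supported D -> comm idker D 1.
Proof.
move=> sD mu nu; rewrite mul1r.
have -> : \sum_(ka <- below nu) idker ka nu * D ka mu =
    \sum_(la <- [fset mu]) idker mu la * D nu la.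
  rewrite big_seq_fset1 /idker eqxx mul1r.
  rewrite (@big_fset_supp _ _ [fset nu]); first by rewrite big_seq_fset1 eqxx mul1r.
    by apply/fsubsetP => t; rewrite in_fset1 => /eqP ->; apply/mem_below.
  by move=> t _; rewrite in_fset1 => /negbTE ->; rewrite mul0r.
apply: sums_to_fin => la; rewrite in_fset1 /idker eq_sym => /negbTE ->.
exact: mul0r.
Qed.

End Kernels.

(** * The one-variable identity as a limit *)

Section OneRow.
Variable R : realType.
Local Notation K := (complex_numField R).
Variables (q s : K).
Hypotheses (q1 : `|q| < 1) (s1 : `|s| < 1).

Lemma q_prod_bounded (c : K) : 0 <= c ->
  exists M, forall n, \prod_(i < n) (1 + c * `|q| ^+ i) <= M.
Proof. exact: prod_1D_geometric_bounded. Qed.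

Lemma s2_norm_lt1 : `|s ^+ 2| < 1.
Proof. by rewrite normrX exprn_ilt1. Qed.

Lemma q_factor_neq0 i : 1 - q * q ^+ i != 0.
Proof. exact: qpoch_factor_neq0. Qed.

Lemma s_factor_neq0 i : 1 - s ^+ 2 * q ^+ i != 0.
Proof. apply: qpoch_factor_neq0 => //; exact: s2_norm_lt1. Qed.

(** [infprod] is a [limn], meaningful only once convergence is known; the increments (a;q)_n a q^n
    decay geometrically. *)
Lemma cvg_qpoch (a : K) : qpoch q a @ \oo --> qpoch_inf q a.
Proof.
suff [l ul] : exists l : K, qpoch q a @ \oo --> l.
  by rewrite /qpoch_inf /infprod (cvg_lim _ ul).
have [M hM] := qpoch_bounded q_prod_bounded a.
apply: (@cvgn_complex_geometric R _ (M * `|a|) q q1) => n.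
rewrite qpochS mulrBr mulr1 addrAC subrr add0r normrN !normrM normrX -!mulrA.
by rewrite ler_wpM2r // mulr_ge0 // exprn_ge0.
Qed.

(** The inverses of the partial products are bounded by some M, so the products stay at distance at
    least 1/M from 0. *)
Lemma qpoch_inf_neq0 (a : K) : `|a| < 1 -> qpoch_inf q a != 0.
Proof.
move=> a1; have [M hM] := qpoch_inv_bounded q1 q_prod_bounded a1.
have M0 : 0 < M by apply: lt_le_trans (hM 0%N); rewrite qpoch0 invr1 normr1.
apply/eqP => l0; have := @cvg_qpoch a; rewrite l0 => /cvgrPdist_lt /(_ M^-1).
rewrite invr_gt0 => /(_ M0) [n _ /(_ n (leqnn n))] /=.
rewrite sub0r normrN; apply/negP; rewrite -real_leNgt ?ger0_real ?invr_ge0 ?(ltW M0) //.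
have u0 : 0 < `|qpoch q a n|.
  by rewrite normr_gt0; apply/prodf_neq0 => i _; exact: qpoch_factor_neq0.
by rewrite -lef_pV2 ?posrE ?invr_gt0 // invrK -normfV.
Qed.

Lemma cvg_shift_ratio (f g : nat -> K) (a b : K) c :
  f @ \oo --> a -> g @ \oo --> b -> b != 0 ->
  (fun n => if (c <= n)%N then f (n - c)%N / g (n - c)%N else 0) @ \oo --> a / b.
Proof.
move=> fa gb b0; rewrite -(cvg_shiftn c) /=.
under eq_fun do rewrite leq_addl addnK.
exact: (cvgM fa (cvgV b0 gb)).
Qed.

Lemma q_inf_neq0 : qpoch_inf q q != 0.
Proof. exact: qpoch_inf_neq0. Qed.

Lemma s_inf_neq0 : qpoch_inf q (s ^+ 2) != 0.
Proof. apply: qpoch_inf_neq0; exact: s2_norm_lt1. Qed.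

Lemma cvg_gw x c : (fun n => gw q s x n c) @ \oo -->
  qpoch_inf q (- (s * x)) / qpoch_inf q q.
Proof. apply: cvg_shift_ratio q_inf_neq0; exact: cvg_qpoch. Qed.

Lemma cvg_phw z c : (fun n => phw q z n c) @ \oo --> qpoch_inf q z / qpoch_inf q q.
Proof. apply: cvg_shift_ratio q_inf_neq0; exact: cvg_qpoch. Qed.

Lemma cvg_bw c : (fun n => bw q s n c) @ \oo -->
  qpoch_inf q q / qpoch_inf q (s ^+ 2).
Proof. apply: cvg_shift_ratio s_inf_neq0; exact: cvg_qpoch. Qed.

Definition row_kernel (x : K) (mu la : intpart) : R[i] := row_weight q s x mu la.

Definition dual_row_kernel (y : K) (nu la : intpart) : R[i] :=
  ct q s la / ct q s nu * row_weight q s y nu la.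

Lemma tame_row x : `|x| < 1 -> tame (row_kernel x).
Proof.
move=> x1; split; first by move=> mu la; exact: row_weight_subpart.
  by exists 1%N => mu la /row_weight_size; rewrite addn1.
move=> N; have [M hM] := row_weight_l1_bounded q1 s1 q_prod_bounded N x1.
by exists M.
Qed.

Lemma tame_dual_row y : `|y| < 1 -> tame (dual_row_kernel y).
Proof.
move=> y1; have nz mu la : dual_row_kernel y mu la != 0 -> row_weight q s y mu la != 0.
  by rewrite mulf_eq0 negb_or => /andP[].
split; first by move=> mu la /nz; exact: row_weight_subpart.
  by exists 1%N => mu la /nz/row_weight_size; rewrite addn1.
move=> N; have [M hM] := row_weight_l1_bounded q1 s1 q_prod_bounded N y1.
have [C hC] := ct_bounded q1 s1 q_prod_bounded N.+1.
exists (C * C * M) => mu smu A.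
have C0 : 0 <= C by apply: le_trans (hC empty_intpart _).1.
apply: (@le_trans _ _ (C * C * \sum_(la <- A) `|row_weight q s y mu la|)); last first.
  by rewrite ler_wpM2l ?mulr_ge0 // hM.
rewrite mulr_sumr; apply: ler_sum => la _.
have [E|nz0] := eqVneq (row_weight q s y mu la) 0.
  by rewrite /dual_row_kernel E mulr0 normr0 mulr0.
rewrite /dual_row_kernel !normrM ler_wpM2r // ler_pM //.
  by apply: (hC la _).1; rewrite (leq_trans (row_weight_size nz0)).
by apply: (hC mu _).2; rewrite leqW.
Qed.

Definition cauchy_factor (x y : K) : K :=
  qpoch_inf q (- (s * x)) * qpoch_inf q (- (s * y)) /
  (qpoch_inf q (s ^+ 2) * qpoch_inf q (x * y)).

Lemma comm_row x y : `|x| < 1 -> `|y| < 1 ->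
  comm (row_kernel x) (dual_row_kernel y) (cauchy_factor x y).
Proof.
move=> x1 y1 mu nu.
have xy1 : `|x * y| < 1 by rewrite normrM mulr_ilt1.
have zinf := qpoch_inf_neq0 xy1; have qinf := q_inf_neq0; have sinf := s_inf_neq0.
have ctnz := ct_neq0 q_factor_neq0 s_factor_neq0.
pose S : K := \sum_(ka <- below nu) row_kernel x ka nu * dual_row_kernel y ka mu.
pose V : K := qpoch_inf q (- (s * x)) / qpoch_inf q q *
  (qpoch_inf q (- (s * y)) / qpoch_inf q q) *
  (\sum_(ka <- below nu) qpoch_inf q q / qpoch_inf q (s ^+ 2) *
    (row_kernel x ka nu * dual_row_kernel y ka mu)).
(* The powers of (q;q)_inf cancel: two in the denominator from [gw], against one from [bw] and one
   from the limit of [phw]. *)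
have -> : cauchy_factor x y * S = V / (qpoch_inf q (x * y) / qpoch_inf q q).
  rewrite /V -mulr_sumr -/S /cauchy_factor.
  move: S zinf qinf sinf (qpoch_inf q (- (s * x))) (qpoch_inf q (- (s * y))).
  move: (qpoch_inf q _) (qpoch_inf q _) (qpoch_inf q _).
  by move=> Z Q P S Z0 Q0 P0 A B; field; rewrite Z0 Q0 P0.
pose v n : K := gw q s x n (entry nu 0) * gw q s y n (entry mu 0) *
  \sum_(ka <- below nu) bw q s n (entry ka 0) *
    (row_kernel x ka nu * dual_row_kernel y ka mu).
have [C hC] := phw_bounded q1 q_prod_bounded (x * y).
have [Mx hMx] := row_weight_l1_bounded q1 s1 q_prod_bounded (size mu) x1.
have [_ _ /(_ (size nu)) [My hMy]] := tame_dual_row y1.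
apply: (@sums_to_weighted_limit K intpart
  (fun la => row_kernel x mu la * dual_row_kernel y nu la)
  (fun n => box n.+1 n) (fun n la => phw q (x * y) n (entry la 0)) C _ V v).
- apply: (@bounded_small_tails R _ _ (Mx * My)) => A.
  apply: (@le_trans _ _ (\sum_(la <- A) `|row_kernel x mu la| * My)).
    apply: ler_sum => la _; rewrite normrM ler_wpM2l //.
    by have := hMy nu (leqnn _) [fset la]; rewrite big_seq_fset1.
  rewrite -mulr_suml ler_wpM2r ?hMx //.
  by have := hMy nu (leqnn _) fset0; rewrite big_seq_fset0.
- move=> A.
  exists (maxn (\max_(la <- A) size (la : intpart))
    (\max_(la <- A) entry (la : intpart) 0)) => // n /=.
  rewrite geq_max => /andP[h1 h2]; apply/fsubsetP => la lA; rewrite mem_box.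
  rewrite (leq_trans _ (leqW h1)) ?(leq_trans _ h2) //.
    exact: (@leq_bigmax_seq _ _ _ (fun la : intpart => entry la 0)).
  exact: (@leq_bigmax_seq _ _ _ (fun la : intpart => size la)).
- exact: le_trans (hC 0%N 0%N).
- by move=> n la; exact: hC.
- by move=> la; exact: cvg_phw.
(* From this n on, the box contains [below nu], outside which the right-hand terms vanish. *)
- exists (maxn (maxn (size mu) (size nu)) (entry nu 0)) => // n /=.
  rewrite !geq_max => /andP[/andP[smu snu] hnu].
  have E := row_cauchy_truncated q_factor_neq0 s_factor_neq0 x y smu snu.
  transitivity ((ct q s nu)^-1 * (\sum_(la <- box n.+1 n) phw q (x * y) n (entry la 0) *
     (row_weight q s x mu la * row_weight q s y nu la * ct q s la))).
    rewrite mulr_sumr; apply: eq_bigr => la _.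
    by rewrite /row_kernel /dual_row_kernel; ring.
  rewrite E mulrCA /v; congr (_ * _).
  rewrite mulr_sumr (@big_fset_supp _ _ (below nu)).
  + apply: eq_bigr => ka _; rewrite /row_kernel /dual_row_kernel.
    by field; rewrite !ctnz.
  + apply/fsubsetP => ka /mem_below h; rewrite mem_box.
    by rewrite (leq_trans (subpart_size h)) ?(leq_trans (h 0%N)).
  + move=> ka _ /mem_below h.
    have [->|/row_weight_subpart//] := eqVneq (row_weight q s x ka nu) 0.
    by rewrite !mul0r !mulr0.
- have h1 : (fun n => gw q s x n (entry nu 0) * gw q s y n (entry mu 0) : K) @ \oo -->
      qpoch_inf q (- (s * x)) / qpoch_inf q q * (qpoch_inf q (- (s * y)) / qpoch_inf q q).
    exact: (cvgM (@cvg_gw x (entry nu 0)) (@cvg_gw y (entry mu 0))).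
  have h2 (ka : intpart) : (fun n => bw q s n (entry ka 0) *
      (row_kernel x ka nu * dual_row_kernel y ka mu) : K) @ \oo -->
      qpoch_inf q q / qpoch_inf q (s ^+ 2) *
      (row_kernel x ka nu * dual_row_kernel y ka mu).
    by apply: cvgMr_tmp; exact: cvg_bw.
  have h3 := @cvg_sum_seq K intpart (below nu) _ _ h2.
  exact: (cvgM h1 h3).
- by rewrite mulf_neq0 ?invr_eq0.
Qed.

End OneRow.

(** * Path configurations *)

Section InfiniteProducts.
Variable K : numFieldType.

Lemma infprod_eventually1 (f : nat -> K) N :
  (forall c, (N <= c)%N -> f c = 1) -> infprod f = \prod_(c < N) f c.
Proof.
move=> f1; apply: lim_near_cst; first exact: norm_hausdorff.
by exists N => // n /= Nn; rewrite (prod_stable Nn).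
Qed.

Lemma infprod_neq0 (f : nat -> K) : infprod f != 0 -> forall c, f c != 0.
Proof.
move=> f0 c; apply: contra_neq f0 => fc.
apply: lim_near_cst; first exact: norm_hausdorff.
by exists c.+1 => // n /= cn; rewrite (bigD1 (Ordinal cn)) //= fc mul0r.
Qed.

End InfiniteProducts.

Lemma part_step_inj (la mu : intpart) : part_step la = part_step mu -> la = mu.
Proof.
move=> E; apply: intpart_eq => i.
have step (nu : intpart) c : entry nu c = (part_step nu c + entry nu c.+1)%N.
  by rewrite /part_step subnK // intpart_nth_anti.
have H d c : (maxn (size la) (size mu) <= c + d)%N -> entry la c = entry mu c.
  elim: d c => [|d IH] c.
    by rewrite addn0 geq_max => /andP[? ?]; rewrite !nth_default.
  by rewrite addnS -addSn => /IH h; rewrite (step la) (step mu) h E.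
by apply: (H (maxn (size la) (size mu))); exact: leq_addl.
Qed.

Section Configurations.
Variables (K : numFieldType) (q s : K).
Hypothesis q_ok : forall i, 1 - q * q ^+ i != 0.

Definition tail_config n (hv : path_config n.+1) : path_config n :=
  (fun r => hv.1 (lift ord0 r), fun r => hv.2 (lift ord0 r)).

Definition cons_config n (mu rho : intpart) (hv : path_config n) : path_config n.+1 :=
  (fun r => if unlift ord0 r is Some r' then hv.1 r'
            else fun c => (entry rho c - entry mu c)%N,
   fun r => if unlift ord0 r is Some r' then hv.2 r' else part_step mu).

Lemma tail_cons_config n mu rho (hv : path_config n) :
  tail_config (cons_config mu rho hv) = hv.
Proof.
case: hv => h v; rewrite /tail_config /cons_config /=.
by congr (_, _); apply/funext => r; rewrite liftK.
Qed.

Definition bottom_row_weight (x : K) n (hv : path_config n.+1) : K :=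
  xpoch q s x (hv.1 ord0 0%N) / qpoch q q (hv.1 ord0 0%N) *
  infprod (fun c => vweight q s x (hv.2 ord0 c) (hv.1 ord0 c)
                        (hv.2 (lift ord0 ord0) c) (hv.1 ord0 c.+1)).

Lemma config_weightS n (x : 'I_n.+1 -> K) hv :
  config_weight q s x hv = bottom_row_weight (x ord0) hv *
    config_weight q s (fun r => x (lift ord0 r)) (tail_config hv).
Proof.
case: hv => h v; rewrite /config_weight /bottom_row_weight big_ord_recl /=.
have -> : widen_ord (leqnSn n.+1) ord0 = ord0 by apply: val_inj.
congr (_ * _); apply: eq_bigr => r _.
by have -> : widen_ord (leqnSn n.+1) (lift ord0 r) = lift ord0 (widen_ord (leqnSn n) r)
  by apply: val_inj.
Qed.

(** For these edges i - l = mu_c - rho_(c+1), so the vertex condition l <= i is the interlacing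
    inequality built into [gw]. *)
Lemma vweight_row_factor x (mu rho : intpart) c : subpart mu rho ->
  vweight q s x (part_step mu c) (entry rho c - entry mu c)%N
    (part_step rho c) (entry rho c.+1 - entry mu c.+1)%N = row_factor q s x mu rho c.
Proof.
move=> h; rewrite /vweight /row_factor /part_step /gw /bw /fw.
have := h c; have := h c.+1.
have := intpart_nth_anti mu (leqnSn c); have := intpart_nth_anti rho (leqnSn c).
move: (entry mu c) (entry mu c.+1) (entry rho c) (entry rho c.+1) => m m' r r' h1 h2 h3 h4.
rewrite h1 h3.
have -> : ((m - m') + (r - m) == (r - r') + (r' - m'))%N by apply/eqP; lia.
rewrite leq_sub2rE //=; case: leqP => _; last by rewrite !mul0r.
rewrite subnBA // subnK //.
by rewrite !invfM; ring.
Qed.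

Lemma bottom_row_weight_cons x n (mu rho : intpart) (hv : path_config n) :
  subpart mu rho -> hv.2 ord0 = part_step rho ->
  bottom_row_weight x (cons_config mu rho hv) = row_weight q s x mu rho.
Proof.
move=> h hv0; rewrite /bottom_row_weight /= liftK !unlift_none hv0.
have E : (fun c => vweight q s x (part_step mu c) (entry rho c - entry mu c)%N
    (part_step rho c) (entry rho c.+1 - entry mu c.+1)%N) = row_factor q s x mu rho.
  by apply/funext => c; exact: vweight_row_factor.
rewrite E /row_weight (infprod_eventually1 (N := maxn (size mu) (size rho))).
  by rewrite [fw _ _ _ _ _]/fw h.
move=> c; rewrite geq_max => /andP[hmu hla]; rewrite /row_factor.
by rewrite !nth_default ?leqW // gw00 fw00 bw00 !mulr1.
Qed.

Lemma vweight_conservation x i j k l : vweight q s x i j k l != 0 -> (i + j = k + l)%N.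
Proof. by rewrite /vweight; case: (eqVneq (i + j)%N (k + l)%N) => // _; rewrite eqxx. Qed.

(** The parts of [rho] are mu_c + h_c: conservation at every vertex makes the vertical edges their
    successive differences, and the vanishing of h far to the right makes them a partition. *)
Lemma config_uncons n (x : K) (la mu : intpart) (hv : path_config n.+1) :
  admissible la mu hv -> bottom_row_weight x hv != 0 ->
  exists rho, [/\ subpart mu rho, hv = cons_config mu rho (tail_config hv)
                & admissible la rho (tail_config hv)].
Proof.
case: hv => h v [/= h_fin v_bot v_top] w0.
have {}w0 : forall c, (part_step mu c + h ord0 c = v (lift ord0 ord0) c + h ord0 c.+1)%N.
  move: w0; rewrite /bottom_row_weight mulf_eq0 negb_or => /andP[_ /infprod_neq0 w0] c.
  by have /= := vweight_conservation (w0 c); rewrite v_bot.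
pose r c := (entry mu c + h ord0 c)%N.
have rS c : (r c = r c.+1 + v (lift ord0 ord0) c)%N.
  have := w0 c; have := intpart_nth_anti mu (leqnSn c); rewrite /part_step /r; lia.
have [N _ hN] := h_fin ord0.
have [rho rhoE] : exists rho : intpart, entry rho =1 r.
  apply: (@exists_intpart _ (maxn N (size mu))) => c; first by rewrite [leqRHS]rS leq_addr.
  by rewrite geq_max /r => /andP[Nc sc]; rewrite nth_default // hN.
have h0 c : h ord0 c = (entry rho c - entry mu c)%N by rewrite rhoE addKn.
have v1 : v (lift ord0 ord0) = part_step rho.
  by apply/funext => c; rewrite /part_step !rhoE [r c]rS addKn.
exists rho; split.
- by move=> c; rewrite rhoE leq_addr.
- rewrite /cons_config /tail_config /=; congr (_, _); apply/funext => r'.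
    by case: unliftP => [j|] ->//; apply/funext => c; rewrite h0.
  by case: unliftP => [j|] ->.
- split => /=; [by move=> r'; exact: h_fin | exact: v1 |].
  by rewrite -v_top; congr v; apply: val_inj.
Qed.

(** Admissible configurations are in general infinitely many, so the list is only asked to cover
    those of nonzero weight. *)
Definition enumerates n (x : 'I_n -> K) (la mu : intpart) (C : seq (path_config n)) :=
  [/\ uniq C, forall hv, hv \in C -> admissible la mu hv
    & forall hv, admissible la mu hv -> config_weight q s x hv != 0 -> hv \in C].

Lemma spinW_enum n (x : 'I_n -> K) la mu C : enumerates x la mu C ->
  spinW q s x la mu = \sum_(hv <- C) config_weight q s x hv.
Proof.
move=> [uC CA AC]; rewrite /spinW (fsbigE C) //.
- rewrite big_mkcond; apply: eq_big_seq => hv hvC.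
  by rewrite mem_set //; exact: CA.
- move=> hv Ahv hvC; apply/eqP; apply: contraNT hvC; exact: AC.
Qed.

Lemma enumerates0 (x : 'I_0 -> K) (la mu : intpart) :
  enumerates x la mu (if mu == la then [:: (fun _ _ => 0%N, fun _ => part_step mu)] else [::]).
Proof.
have E (hv : path_config 0) : admissible la mu hv ->
    mu = la /\ hv = (fun _ _ => 0%N, fun _ => part_step mu).
  case: hv => h v [/= _ v0 v1]; split.
    by apply: part_step_inj; rewrite -v0 -v1; congr v; apply: val_inj.
  congr (_, _); apply/funext => r; first by case: r.
  by rewrite ord1.
split.
- by case: ifP.
- move=> hv; case: eqP => // <-; rewrite inE => /eqP ->.
  by split => // -[].
- by move=> hv /E[<- ->] _; rewrite eqxx mem_head.
Qed.

Lemma admissible_subpart n (x : 'I_n -> K) (la mu : intpart) hv :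
  admissible la mu hv -> config_weight q s x hv != 0 -> subpart mu la.
Proof.
elim: n x mu hv => [|n IH] x mu hv.
  case: hv => h v [/= _ v0 v1] _; have -> // : mu = la.
  by apply: part_step_inj; rewrite -v0 -v1; congr v; apply: val_inj.
move=> Ahv; rewrite config_weightS mulf_eq0 negb_or => /andP[w0 wt].
have [rho [mr _ At]] := config_uncons Ahv w0.
exact: subpart_trans mr (IH _ _ _ At wt).
Qed.

Lemma admissible_cons n (la mu rho : intpart) (hv : path_config n) :
  admissible la rho hv -> admissible la mu (cons_config mu rho hv).
Proof.
case: hv => h v [/= h_fin v0 v1]; split => /=.
- move=> r; case: unliftP => [j|] _; first exact: h_fin.
  exists (size rho) => // c /= sc; rewrite nth_default //.
- by rewrite unlift_none.
- have -> : ord_max = lift ord0 ord_max :> 'I_n.+2 by apply: val_inj.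
  by rewrite liftK.
Qed.

Lemma enumeratesS n (x : 'I_n.+1 -> K) (la mu : intpart)
    (C : intpart -> seq (path_config n)) :
  (forall rho, enumerates (fun r => x (lift ord0 r)) la rho (C rho)) ->
  enumerates x la mu
    [seq cons_config mu rho hv | rho <- [seq rho <- below la | `[< subpart mu rho >]], hv <- C rho].
Proof.
move=> hC; split.
- apply: allpairs_uniq_dep.
  + by rewrite filter_uniq ?fset_uniq.
  + by move=> rho _; have [] := hC rho.
  + move=> [rho hv] [rho' hv'] /allpairsPdep[r1 [c1 [_ h1 /= [-> ->]]]].
    move=> /allpairsPdep[r2 [c2 [_ h2 /= [-> ->]]]].
    (* The tail is recovered by [tail_config], and its bottom boundary determines [rho] through
       [part_step_inj]. *)
    move=> /(congr1 (@tail_config _)); rewrite !tail_cons_config => E.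
    move: h1 h2; rewrite E => h1 h2.
    have [_ /(_ _ h1) [_ s1 _] _] := hC r1; have [_ /(_ _ h2) [_ s2 _] _] := hC r2.
    by rewrite (part_step_inj (etrans (esym s1) s2)).
- move=> hv /allpairsPdep[rho [hv' [_ h ->]]]; apply: admissible_cons.
  by have [_ /(_ _ h)] := hC rho.
- move=> hv Ahv; rewrite config_weightS mulf_eq0 negb_or => /andP[w0 wt].
  have [rho [mr E At]] := config_uncons Ahv w0.
  apply/allpairsPdep; exists rho, (tail_config hv); split => //.
    rewrite mem_filter; apply/andP; split; first exact/asboolP.
    apply/mem_below; exact: admissible_subpart wt.
  by have [_ _ /(_ _ At wt)] := hC rho.
Qed.

Lemma exists_enumerates n (x : 'I_n -> K) la mu : exists C, enumerates x la mu C.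
Proof.
elim: n x mu => [|n IH] x mu; first by eexists; exact: enumerates0.
have [C hC] := choice (IH (fun r => x (lift ord0 r))).
by eexists; exact: (enumeratesS mu hC).
Qed.

Lemma spinW0 (x : 'I_0 -> K) la mu : spinW q s x la mu = (mu == la)%:R.
Proof.
rewrite (spinW_enum (enumerates0 x la mu)); case: eqP => _; last by rewrite big_nil.
by rewrite big_seq1 /config_weight big_ord0.
Qed.

(** The branching rule, obtained by removing the bottom row; it makes [spinW] an iterated
    composition of one-row kernels. *)
Lemma spinWS n (x : 'I_n.+1 -> K) la mu : spinW q s x la mu =
  \sum_(rho <- below la) row_weight q s (x ord0) mu rho *
     spinW q s (fun r => x (lift ord0 r)) la rho.
Proof.
have [C hC] := choice (exists_enumerates (fun r => x (lift ord0 r)) la).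
rewrite (spinW_enum (enumeratesS mu hC)) big_allpairs_dep big_filter big_mkcond.
apply: eq_bigr => rho _; rewrite (spinW_enum (hC rho)); case: asboolP => [h|h]; last first.
  have [->|/row_weight_subpart//] := eqVneq (row_weight q s (x ord0) mu rho) 0.
  by rewrite mul0r.
rewrite mulr_sumr; apply: eq_big_seq => hv hvC; rewrite config_weightS tail_cons_config.
by rewrite bottom_row_weight_cons //; have [_ /(_ _ hvC) []] := hC rho.
Qed.

End Configurations.

(** * Several variables *)

Lemma nth_conj_parts (la : intpart) j : entry (conj_parts la) j = count (fun p => j < p)%N la.
Proof.
rewrite /conj_parts; have [lt_j|le_j] := ltnP j (head 0%N la).
  by rewrite (nth_map 0%N) ?size_iota // nth_iota.
rewrite nth_default ?size_map ?size_iota //; apply/esym/eqP.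
rewrite -leqn0 leqNgt -has_count; apply/hasPn => p /(nthP 0%N)[i _ <-].
by rewrite -leqNgt (leq_trans _ le_j) // -nth0 intpart_nth_anti.
Qed.

Lemma leq_count_gt (s t : seq nat) j : (forall i, entry s i <= entry t i)%N ->
  (size s <= size t)%N -> (count (fun p => j < p) s <= count (fun p => j < p) t)%N.
Proof.
elim: s t => [|a s IH] [|b t] // st sz; rewrite /= leq_add ?IH //.
  by have /= := st 0%N; case: ltnP => // ja /(leq_trans ja) ->.
by move=> i; exact: (st i.+1).
Qed.

(** This places the support of both sums inside the domains of the theorem. The lengths of the
    conjugates are the first parts. *)
Lemma subpart_contains_conj (mu la : intpart) : subpart mu la ->
  contains (conj_intpart la) (conj_intpart mu).
Proof.
move=> h; split.
  by rewrite /= !size_map !size_iota -!nth0.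
by move=> i; rewrite !nth_conj_parts leq_count_gt // subpart_size.
Qed.

Section MultiRow.
Variables (R : realType) (q s : R[i]).
Hypotheses (q1 : `|q| < 1) (s1 : `|s| < 1).

Let q_ok := @q_factor_neq0 R q q1.
Let s_ok := @s_factor_neq0 R q s q1 s1.

Definition kernel n (x : 'I_n -> R[i]) (mu la : intpart) : R[i] := spinW q s x la mu.

Definition dual_kernel n (y : 'I_n -> R[i]) (nu la : intpart) : R[i] :=
  spinW_dual q s y la nu.

Lemma kernel0 (x : 'I_0 -> R[i]) : kernel x = idker R.
Proof. by apply/funext => mu; apply/funext => la; exact: spinW0. Qed.

Lemma kernelS n (x : 'I_n.+1 -> R[i]) :
  kernel x = kernel_comp (row_kernel q s (x ord0)) (kernel (fun r => x (lift ord0 r))).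
Proof. by apply/funext => mu; apply/funext => la; exact: spinWS. Qed.

Lemma dual_kernel0 (y : 'I_0 -> R[i]) : dual_kernel y = idker R.
Proof.
apply/funext => mu; apply/funext => la; rewrite /dual_kernel /spinW_dual spinW0 /idker.
by case: eqP => [->|_]; rewrite ?mulr0 // mulr1 divff //; exact: ct_neq0.
Qed.

(** The quotient of [ct] at [la] and [mu] factors through [rho], so the dual normalisation is
    compatible with composition. *)
Lemma dual_kernelS n (y : 'I_n.+1 -> R[i]) :
  dual_kernel y =
  kernel_comp (dual_row_kernel q s (y ord0)) (dual_kernel (fun r => y (lift ord0 r))).
Proof.
apply/funext => mu; apply/funext => la.
rewrite /dual_kernel /spinW_dual spinWS // /kernel_comp mulr_sumr; apply: eq_bigr => rho _.
rewrite /dual_row_kernel -/(ct q s rho) -/(ct q s la) -/(ct q s mu).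
have : ct q s mu != 0 by exact: ct_neq0.
have : ct q s rho != 0 by exact: ct_neq0.
move: (ct _ _ _) (ct _ _ _) (ct _ _ _) (row_weight _ _ _ _ _) (spinW _ _ _ _ _).
by move=> a b c d e c0 b0; field; rewrite b0 c0.
Qed.

Lemma tame_kernel n (x : 'I_n -> R[i]) : (forall i, `|x i| < 1) -> tame (kernel x).
Proof.
elim: n x => [|n IH] x x1; first by rewrite kernel0; exact: tame_idker.
rewrite kernelS; apply: tame_comp; first exact: tame_row.
by apply: IH => i; exact: x1.
Qed.

Lemma tame_dual_kernel n (y : 'I_n -> R[i]) :
  (forall i, `|y i| < 1) -> tame (dual_kernel y).
Proof.
elim: n y => [|n IH] y y1; first by rewrite dual_kernel0; exact: tame_idker.
rewrite dual_kernelS; apply: tame_comp; first exact: tame_dual_row.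
by apply: IH => i; exact: y1.
Qed.

Lemma comm_row_dual_kernel (x : R[i]) n (y : 'I_n -> R[i]) : `|x| < 1 ->
  (forall j, `|y j| < 1) ->
  comm (row_kernel q s x) (dual_kernel y) (\prod_(j < n) cauchy_factor q s x (y j)).
Proof.
move=> x1 y1; have tx : tame (row_kernel q s x) by exact: tame_row.
have [sx _ _] := tx; have [sy _ _] := tame_dual_kernel y1.
(* The dual kernel is put in the argument in which [comm_comp] composes, so that its rows can be
   added one at a time. *)
apply: comm_sym => //; elim: n y y1 {sy} => [|n IH] y y1.
  by rewrite dual_kernel0 big_ord0; exact: comm_idker.
have ty0 : tame (dual_row_kernel q s (y ord0)) by exact: tame_dual_row.
have y1' j : `|y (lift ord0 j)| < 1 by exact: y1.
rewrite dual_kernelS big_ord_recl; apply: comm_comp => //.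
- exact: tame_dual_kernel.
- have [sy0 _ _] := ty0; apply: comm_sym => //; exact: comm_row.
- exact: IH.
Qed.

Lemma comm_kernels m n (x : 'I_m -> R[i]) (y : 'I_n -> R[i]) :
  (forall i, `|x i| < 1) -> (forall j, `|y j| < 1) ->
  comm (kernel x) (dual_kernel y)
    (\prod_(i < m) \prod_(j < n) cauchy_factor q s (x i) (y j)).
Proof.
move=> x1 y1; have ty := tame_dual_kernel y1; have [sy _ _] := ty.
elim: m x x1 => [|m IH] x x1.
  by rewrite kernel0 big_ord0; exact: comm_idker.
have x1' i : `|x (lift ord0 i)| < 1 by exact: x1.
rewrite kernelS big_ord_recl; apply: comm_comp => //.
- exact: tame_row.
- exact: tame_kernel.
- exact: comm_row_dual_kernel.
- exact: IH.
Qed.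

End MultiRow.

Local Open Scope complex_scope.

Theorem theorem7p1 (R : realType) (m n : nat) (hm : (0 < m)%N) (hn : (0 < n)%N)
    (mu nu : intpart) (q s : R[i]) (x : 'I_m -> R[i]) (y : 'I_n -> R[i])
    (hq : `|q| < 1) (hs : `|s| < 1)
    (hx : forall i : 'I_m, `|x i| < 1) (hy : forall j : 'I_n, `|y j| < 1) :
  has_sum
    [set la : intpart |
       contains (conj_intpart la) (conj_intpart mu) /\
       contains (conj_intpart la) (conj_intpart nu)]
    (fun la : intpart => spinW q s x la mu * spinW_dual q s y la nu)
    ((\prod_(i < m) \prod_(j < n)
        (qpoch_inf q (- (s * x i)) * qpoch_inf q (- (s * y j))
           / (qpoch_inf q (s ^+ 2) * qpoch_inf q (x i * y j)))) *
     \sum_(ka \in [set ka : intpart |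
                     contains (conj_intpart mu) (conj_intpart ka) /\
                     contains (conj_intpart nu) (conj_intpart ka)])
        spinW q s x nu ka * spinW_dual q s y mu ka).
Proof.
have [sx _ _] := tame_kernel hq hs hx; have [sy _ _] := tame_dual_kernel hq hs hy.
apply: sums_to_has_sum => [la|].
  rewrite mulf_eq0 negb_or => /andP[/sx h1 /sy h2].
  by split; exact: subpart_contains_conj.
have := comm_kernels hq hs hx hy mu nu.
rewrite /comm; set D := (X in \sum_(_ \in X) _).
have D_supp ka : kernel q s x ka nu * dual_kernel q s y ka mu != 0 -> ka \in D.
  rewrite mulf_eq0 negb_or => /andP[/sx h1 /sy h2].
  by rewrite mem_set //; split; exact: subpart_contains_conj.
suff -> : \sum_(ka <- below nu) kernel q s x ka nu * dual_kernel q s y ka mu =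
  \sum_(ka \in D) spinW q s x nu ka * spinW_dual q s y mu ka by [].
(* The finite-support sum is evaluated on an explicit list; [below nu] contains the support. *)
rewrite (fsbigE [seq ka <- below nu | ka \in D]).
- rewrite big_filter_cond [RHS]big_mkcond; apply: eq_bigr => ka _.
  by rewrite andbb; case: ifPn => // /negP; apply: contra_notP => /eqP/D_supp.
- by rewrite filter_uniq ?fset_uniq.
- by move=> ka /=; rewrite mem_filter => /andP[/set_mem].
- move=> ka Dka; rewrite mem_filter mem_set //= => hka; apply/eqP.
  apply: contraNT hka; rewrite mulf_eq0 negb_or => /andP[/sx h _].
  exact/mem_below.
Qed.
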